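(* Let $(A,\Phi)$ be an $\ell$CEDS and $\mathcal{D}$ a set. Let $a\in A$ be a nonzero special vector of $(A,\Phi)$ of eigenvalue $1$ and let $f\in A^*$ such that $f(a)=1$. The pre-Lie algebra $(\mathfrak{g}_{A,\mathcal{D}},\circ_a)$ is freely generated by the space of trees $T$ such that any edge born from the root of $T$ is typed by an element of $\ker(f)$.
   Context: $\mathbb{K}$ is a field of characteristic zero and all vector spaces are over $\mathbb{K}$; $\tau$ is the flip of $A\otimes A$. Pre-Lie means left pre-Lie: $x\bullet(y\bullet z)-(x\bullet y)\bullet z=y\bullet(x\bullet z)-(y\bullet x)\bullet z$. An $\ell$CEDS is a pair $(A,\Phi)$ with $A$ a vector space and $\Phi:A\otimes A\to A\otimes A$ linear such that $(\mathrm{Id}\otimes\Phi)\circ(\Phi\otimes\mathrm{Id})\circ(\mathrm{Id}\otimes\Phi)=(\Phi\otimes\mathrm{Id})\circ(\mathrm{Id}\otimes\tau)\circ(\Phi\otimes\mathrm{Id})$ and $(\mathrm{Id}\otimes\Phi)\circ(\mathrm{Id}\otimes\tau)\circ(\tau\otimes\mathrm{Id})\circ(\Phi\otimes\mathrm{Id})=(\tau\otimes\mathrm{Id})\circ(\Phi\otimes\mathrm{Id})\circ(\mathrm{Id}\otimes\Phi)\circ(\mathrm{Id}\otimes\tau)$. Formal Sweedler notation: $\Phi(a\otimes b)=\sum a'\rightarrow b'\otimes a''\triangleright b''$. A vector $a\in A$ is a special vector of eigenvalue $1$ if $\Phi(a\otimes a)=a\otimes a$. An $A$-typed and $\mathcal{D}$-decorated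 rooted tree is a (non-planar) rooted tree whose vertices are decorated by elements of $\mathcal{D}$ and whose edges are typed by elements of $A$; $\mathfrak{g}_{A,\mathcal{D}}$ is the vector space generated by them, trees being linear in the type of each edge. $B_d(a_1T_1,\ldots,a_kT_k)$ is the tree obtained by grafting $T_1,\ldots,T_k$ on a common root decorated by $d$, the edge from the root to the root of $T_i$ being of type $a_i$ (extended multilinearly; for $k=0$ it is the single vertex decorated by $d$). The edges born from the root are the edges incident to the root. The products $\circ_a$ on $\mathfrak{g}_{A,\mathcal{D}}$ ($a\in A$) are defined inductively by $$T\circ_a B_d(a_1T_1,\ldots,a_kT_k)=B_d(aT,a_1T_1,\ldots,a_kT_k)+\sum_{i=1}^k\sum B_d(a_1T_1,\ldots,(a'\rightarrow a_i')(T\circ_{a''\triangleright a_i''}T_i),\ldots,a_kT_k).$$ When $a$ is a special vector of eigenvalue $1$, $\circ_a$ is a pre-Lie product. *)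

(* Defs.v *)
From HB Require Import structures.
From mathcomp Require Import all_boot all_algebra.
From mathcomp Require Import boolp.
From mathcomp Require Import freeg.
From mathcomp Require Import generic_quotient ring_quotient.

Set Implicit Arguments.
Unset Strict Implicit.
Unset Printing Implicit Defensive.

Import GRing.Theory.
Local Open Scope ring_scope.
Local Open Scope quotient_scope.

Section Span.
Variables (K : fieldType) (V : lmodType K).

Inductive in_span (S : V -> Prop) : V -> Prop :=
| in_span0 : in_span S 0
| in_spanD k u v : S u -> in_span S v -> in_span S (k *: u + v).

Definition span (S : V -> Prop) : pred V := fun v => `[< in_span S v >].

Lemma in_spanP S v : reflect (in_span S v) (v \in span S).
Proof. exact: asboolP. Qed.

Lemma span_lin S k : {in span S &, forall u v, k *: u + v \in span S}.
Proof.
move=> u v /in_spanP uS /in_spanP vS; apply/in_spanP.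
elim: uS => [|l w w' Sw _ IH]; first by rewrite scaler0 add0r.
by rewrite scalerDr scalerA -addrA; apply: in_spanD.
Qed.

Lemma span0 S : 0 \in span S.
Proof. by apply/in_spanP; constructor. Qed.

Lemma span_zmod_closed S : zmod_closed (span S).
Proof.
split=> [|u v uS vS]; first exact: span0.
by rewrite addrC -scaleN1r span_lin.
Qed.

HB.instance Definition _ S := GRing.isZmodClosed.Build V (span S)
  (span_zmod_closed S).

Lemma spanZ S k v : v \in span S -> k *: v \in span S.
Proof. by move=> vS; rewrite -[_ *: _]addr0 span_lin ?span0. Qed.

Lemma mem_span (S : V -> Prop) v : S v -> v \in span S.
Proof.
move=> Sv; apply/in_spanP; rewrite -[v]addr0 -[v]scale1r.
by apply: in_spanD => //; constructor.
Qed.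

(* The quotient of V by the span of S. *)
Definition quotsp (S : V -> Prop) : Type := 
  @Quotient.quot V (GRing.ZmodClosed.clone V (span S) _).

HB.instance Definition _ S := GRing.Zmodule.on (quotsp S).
HB.instance Definition _ S := Quotient.on (quotsp S).

Definition quotsp_scale S (k : K) (u : quotsp S) : quotsp S :=
  \pi_(quotsp S) (k *: repr u).

Lemma quotsp_eqP S u v :
  reflect (\pi_(quotsp S) u = \pi_(quotsp S) v) (u - v \in span S).
Proof. by rewrite Quotient.idealrBE; apply: eqP. Qed.

Lemma quotsp_piD S u v :
  \pi_(quotsp S) (u + v) = \pi_(quotsp S) u + \pi_(quotsp S) v.
Proof. exact: Quotient.pi_add. Qed.

Lemma quotsp_pi_scale S k v :
  quotsp_scale k (\pi_(quotsp S) v) = \pi_(quotsp S) (k *: v).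
Proof.
apply/quotsp_eqP; rewrite -scalerBr spanZ //.
by apply/quotsp_eqP; rewrite reprK.
Qed.

Fact quotsp_scalerA S k l (u : quotsp S) :
  quotsp_scale k (quotsp_scale l u) = quotsp_scale (k * l) u.
Proof.
by rewrite -[u]reprK [quotsp_scale l _]quotsp_pi_scale !quotsp_pi_scale scalerA.
Qed.

Fact quotsp_scale1r S : left_id 1 (@quotsp_scale S).
Proof. by move=> u; rewrite -[u]reprK !quotsp_pi_scale scale1r. Qed.

Fact quotsp_scalerDr S : right_distributive (@quotsp_scale S) +%R.
Proof.
move=> k u v; rewrite -[u]reprK -[v]reprK -quotsp_piD !quotsp_pi_scale.
by rewrite -quotsp_piD scalerDr.
Qed.

Fact quotsp_scalerDl S (u : quotsp S) :
  {morph (@quotsp_scale S)^~ u : k l / k + l}.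
Proof.
move=> k l; rewrite -[u]reprK !quotsp_pi_scale -quotsp_piD.
by rewrite scalerDl.
Qed.

HB.instance Definition _ S := GRing.Zmodule_isLmodule.Build K (quotsp S)
  (@quotsp_scalerA S) (@quotsp_scale1r S) (@quotsp_scalerDr S)
  (@quotsp_scalerDl S).

Lemma quotsp_pi_linear S : linear (\pi_(quotsp S)).
Proof. by move=> k u v; rewrite quotsp_piD -quotsp_pi_scale. Qed.

End Span.

Section Presented.
Variables (K : fieldType) (X : choiceType) (rel : {freeg X / K} -> Prop).

(* The vector space generated by X subject to the relations rel = 0. *)
Definition pres : Type := quotsp rel.

HB.instance Definition _ := GRing.Lmodule.on pres.
HB.instance Definition _ := Quotient.on pres.

Definition gen (x : X) : pres := \pi_pres << x >>.

Variable V : lmodType K.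

(* Linear extension of f : X -> V. It is computed on a chosen representative
   \sum_i k_i <<x_i>> of u, hence meaningful when f respects rel
   (lext_linear, lext_gen). *)
Definition lext (f : X -> V) (u : pres) : V := fglift f (repr u).

End Presented.

Arguments gen {K X rel} x.

Section PresentedTheory.
Variables (K : fieldType) (X : choiceType).
Implicit Types (V : lmodType K) (rel : {freeg X / K} -> Prop).

Lemma fglift_add V (f : X -> V) D E : fglift f (D + E) = fglift f D + fglift f E.
Proof.
have add := lift_is_additive f.
have fN D' : fglift f (- D') = - fglift f D'.
  by rewrite -[- D']sub0r add -[0](subrr 0) add subrr sub0r.
by rewrite -{1}[E]opprK add fN opprK.
Qed.

Lemma fglift_sumE V (f : X -> V) D :
  fglift f D = \sum_(x <- dom D) coeff x D *: f x.
Proof.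
rewrite -{1}[D]freeg_sumE.
elim: (dom D) => [|x s IH]; last by rewrite !big_cons fglift_add liftU IH.
by rewrite !big_nil -[0](subrr 0) (lift_is_additive f) subrr.
Qed.

Lemma fglift_linear V (f : X -> V) : linear (fglift f).
Proof.
move=> k D E; rewrite fglift_add; congr (_ + _).
rewrite fglift_sumE [in RHS]fglift_sumE scaler_sumr.
have [->|k0] := eqVneq k 0.
  rewrite scale0r dom0 big_nil big1 // => x _; exact: scale0r.
rewrite (perm_big (dom D)) /=; last first.
  by apply: uniq_perm; rewrite ?uniq_dom //; apply: domZ.
by apply: eq_bigr => x _; rewrite coeffZ scalerA.
Qed.

Lemma fglift_zero V (f : X -> V) : fglift f 0 = 0.
Proof. by rewrite fglift_sumE dom0 big_nil. Qed.

Lemma fgliftU V (f : X -> V) x : fglift f << x >> = f x.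
Proof. by rewrite liftU scale1r. Qed.

Variables (rel : {freeg X / K} -> Prop).

Lemma gen_ind (P : pres rel -> Prop) :
  P 0 -> (forall k x u, P u -> P (k *: gen x + u)) -> forall u, P u.
Proof.
move=> P0 PD u; rewrite -[u]reprK -[repr u]freeg_sumE.
elim: (dom _) => [|x s IH].
  rewrite big_nil; suff -> : \pi_(pres rel) 0 = 0 by [].
  by have := @quotsp_pi_linear K _ rel (-1) 0 0; rewrite scaleN1r addNr scaleN1r addNr.
rewrite big_cons -[coeff _ _]mulr1.
have -> (c : K) : << c * 1 *g x >> = c *: << x >> :> {freeg X / K}.
  by apply/eqP/freeg_eqP => y; rewrite coeffZ !coeffU mulr1 mul1r.
by have -> := @quotsp_pi_linear K _ rel; apply: PD.
Qed.

Lemma lext_add V (k : K) (f g : X -> V) (u : pres rel) :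
  lext (fun x => k *: f x + g x) u = k *: lext f u + lext g u.
Proof.
rewrite /lext !fglift_sumE scaler_sumr -big_split; apply: eq_bigr => x _ /=.
by rewrite scalerDr !scalerA mulrC.
Qed.

Lemma eq_lext V (f g : X -> V) (u : pres rel) : f =1 g -> lext f u = lext g u.
Proof. by move=> fg; rewrite /lext !fglift_sumE; apply: eq_bigr => x _; rewrite fg. Qed.

Section Respect.
Variables (V : lmodType K) (f : X -> V).
Hypothesis frel : forall D, rel D -> fglift f D = 0.

Lemma lext_pi D : lext f (\pi_(pres rel) D) = fglift f D.
Proof.
apply/eqP; rewrite -subr_eq0 /lext.
have <- : fglift f (repr (\pi_(pres rel) D) - D) =
          fglift f (repr (\pi_(pres rel) D)) - fglift f D.
  exact: lift_is_additive.
have : repr (\pi_(pres rel) D) - D \in span rel by apply/quotsp_eqP; rewrite reprK.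
move=> /in_spanP; elim=> [|k u v ru _ /eqP IH]; first by rewrite fglift_zero.
by rewrite fglift_linear frel // scaler0 add0r IH.
Qed.

Lemma lext_gen x : lext f (gen x : pres rel) = f x.
Proof. by rewrite lext_pi fgliftU. Qed.

Lemma lext_linear : linear (lext f : pres rel -> V).
Proof.
move=> k u v; rewrite -[u in LHS]reprK -[v in LHS]reprK.
by have <- := @quotsp_pi_linear K _ rel; rewrite lext_pi fglift_linear.
Qed.

End Respect.

End PresentedTheory.

Section Tensor.
Variables (K : fieldType) (V W : lmodType K).

Inductive tens_rel : {freeg (V * W)%type / K} -> Prop :=
| tens_rell k v v' w :
    tens_rel (<< (k *: v + v', w) >> - (k *: << (v, w) >> + << (v', w) >>))
| tens_relr k v w w' :
    tens_rel (<< (v, k *: w + w') >> - (k *: << (v, w) >> + << (v, w') >>)).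

Definition tens : Type := pres tens_rel.

HB.instance Definition _ := GRing.Lmodule.on tens.

Definition tensor (v : V) (w : W) : tens := gen (v, w).

Variable U : lmodType K.

(* The linear map tensor v w |-> f v w, for f bilinear (tlift_tensor). *)
Definition tlift (f : V -> W -> U) : tens -> U :=
  lext (fun p => f p.1 p.2).

End Tensor.

Section TensorTheory.
Variables (K : fieldType) (V W : lmodType K).

Section Bilinear.
Variables (U : lmodType K) (f : V -> W -> U).
Hypotheses (fl : forall w, linear (f^~ w)) (fr : forall v, linear (f v)).

Let frel D : tens_rel D -> fglift (fun p => f p.1 p.2) D = 0.
Proof.
have fN (g : V * W -> U) E F : fglift g (E - F) = fglift g E - fglift g F.
  exact: lift_is_additive.
case=> [k v v' w|k v w w']; rewrite fN fglift_linear !fgliftU /=.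
  by rewrite fl subrr.
by rewrite fr subrr.
Qed.

Lemma tlift_linear : linear (tlift f).
Proof. exact: lext_linear. Qed.

Lemma tlift_tensor v w : tlift f (tensor v w) = f v w.
Proof. exact: lext_gen. Qed.

End Bilinear.

Lemma tlift_add (U : lmodType K) k (f g : V -> W -> U) u :
  tlift (fun v w => k *: f v w + g v w) u = k *: tlift f u + tlift g u.
Proof. exact: lext_add. Qed.

Lemma eq_tlift (U : lmodType K) (f g : V -> W -> U) u :
  f =2 g -> tlift f u = tlift g u.
Proof. by move=> fg; apply: eq_lext => p; apply: fg. Qed.

Let tens_relE k (p p1 p2 : V * W) :
  tens_rel (<< p >> - (k *: << p1 >> + << p2 >>) : {freeg (V * W)%type / K}) ->
  gen p = k *: gen p1 + gen p2 :> tens V W.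
Proof.
move=> r; rewrite /gen.
have <- := @quotsp_pi_linear K _ (@tens_rel K V W).
by apply/quotsp_eqP; apply: mem_span.
Qed.

Lemma tensor_linl (w : W) : linear (fun v : V => tensor v w).
Proof. by move=> k v v'; apply/tens_relE/tens_rell. Qed.

Lemma tensor_linr (v : V) : linear (tensor v : W -> tens V W).
Proof. by move=> k w w'; apply/tens_relE/tens_relr. Qed.

End TensorTheory.

Section TensorMaps.
Variable K : fieldType.
Implicit Types U V W : lmodType K.

Definition tmap V W V' W' (f : V -> V') (g : W -> W') : tens V W -> tens V' W' :=
  tlift (fun v w => tensor (f v) (g w)).

Definition tflip V W : tens V W -> tens W V := tlift (fun v w => tensor w v).

Definition tassoc U V W : tens (tens U V) W -> tens U (tens V W) :=
  tlift (fun t w => tlift (fun u v => tensor u (tensor v w)) t).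

Definition tassocV U V W : tens U (tens V W) -> tens (tens U V) W :=
  tlift (fun u t => tlift (fun v w => tensor (tensor u v) w) t).

Section Tmap.
Variables (V W V' W' : lmodType K) (f : V -> V') (g : W -> W').
Hypotheses (f_lin : linear f) (g_lin : linear g).

Let tmap_l w : linear (fun v => tensor (f v) (g w)).
Proof. by move=> k v v'; rewrite f_lin tensor_linl. Qed.

Let tmap_r v : linear (fun w => tensor (f v) (g w)).
Proof. by move=> k w w'; rewrite g_lin tensor_linr. Qed.

Lemma tmap_linear : linear (tmap f g).
Proof. exact: tlift_linear. Qed.

Lemma tmap_tensor v w : tmap f g (tensor v w) = tensor (f v) (g w).
Proof. exact: (@tlift_tensor _ _ _ _ (fun v w => tensor (f v) (g w))). Qed.

End Tmap.

Lemma tflip_linear V W : linear (@tflip V W).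
Proof.
by apply: tlift_linear => [w|v]; [exact: tensor_linr | exact: tensor_linl].
Qed.

Lemma tflip_tensor V W (v : V) (w : W) : tflip (tensor v w) = tensor w v.
Proof.
by apply: (tlift_tensor (f := fun v w => tensor w v)) => [w'|v'];
  [exact: tensor_linr | exact: tensor_linl].
Qed.

Section Tassoc.
Variables U V W : lmodType K.

Let assoc_l (w : W) (u : U) :
  linear (fun v : V => tensor u (tensor v w)).
Proof. by move=> k v v'; rewrite tensor_linl tensor_linr. Qed.

Let assocV_r (u : U) (v : V) : linear (fun w : W => tensor (tensor u v) w).
Proof. exact: tensor_linr. Qed.

Let assocV_l (u : U) (w : W) : linear (fun v : V => tensor (tensor u v) w).
Proof. by move=> k v v'; rewrite tensor_linr tensor_linl. Qed.

Lemma tassoc_tensor (u : U) (v : V) (w : W) :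
  tassoc (tensor (tensor u v) w) = tensor u (tensor v w).
Proof.
pose f t (w : W) : tens U (tens V W) :=
  tlift (fun u v => tensor u (tensor v w)) t.
have -> : tassoc (tensor (tensor u v) w) = f (tensor u v) w.
  apply: (tlift_tensor (f := f)) => [w'|t] k x y.
    by apply: tlift_linear => [v'|u']; [exact: tensor_linl | exact: assoc_l].
  by rewrite -tlift_add; apply: eq_tlift => u' v'; rewrite !tensor_linr.
apply: (tlift_tensor (f := fun u v => tensor u (tensor v w))) => [v'|u'].
  exact: tensor_linl.
exact: assoc_l.
Qed.

Lemma tassocV_tensor (u : U) (v : V) (w : W) :
  tassocV (tensor u (tensor v w)) = tensor (tensor u v) w.
Proof.
pose f (u : U) t : tens (tens U V) W :=
  tlift (fun v w => tensor (tensor u v) w) t.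
have -> : tassocV (tensor u (tensor v w)) = f u (tensor v w).
  apply: (tlift_tensor (f := f)) => [t|u'] k x y.
    by rewrite -tlift_add; apply: eq_tlift => v' w'; rewrite !tensor_linl.
  by apply: tlift_linear => [w'|v']; [exact: assocV_l | exact: assocV_r].
apply: (tlift_tensor (f := fun v w => tensor (tensor u v) w)) => [w'|v'].
  exact: assocV_l.
exact: assocV_r.
Qed.

End Tassoc.

End TensorMaps.

Section LCEDS.
Variables (K : fieldType) (A : lmodType K).
Implicit Types F : tens A A -> tens A A.

(* F (x) Id and Id (x) F on the threefold tensor power A (x) (A (x) A). *)
Definition act12 F : tens A (tens A A) -> tens A (tens A A) :=
  @tassoc K A A A \o tmap F idfun \o @tassocV K A A A.

Definition act23 F : tens A (tens A A) -> tens A (tens A A) := tmap idfun F.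

Definition is_lCEDS (Phi : {linear tens A A -> tens A A}) : Prop :=
  let tau := @tflip K A A in
  (act23 Phi \o act12 Phi \o act23 Phi =1 act12 Phi \o act23 tau \o act12 Phi)
  /\ (act23 Phi \o act23 tau \o act12 tau \o act12 Phi =1
      act12 tau \o act12 Phi \o act23 Phi \o act23 tau).

Definition special1 (Phi : {linear tens A A -> tens A A}) (a : A) : Prop :=
  Phi (tensor a a) = tensor a a.

End LCEDS.

(* A planar representative of a rooted tree: the decoration of the root, and
   the list of its edges, each with its type and the subtree it leads to. *)
Inductive ttree (A D : Type) : Type := Node of D & seq (A * ttree A D).
Arguments Node {A D}.

HB.instance Definition _ (A D : Type) := gen_eqMixin (ttree A D).
HB.instance Definition _ (A D : Type) := gen_choiceMixin (ttree A D).

Section Trees.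
Variables (K : fieldType) (A : lmodType K) (D : Type).
Local Notation tree := (ttree A D).
Implicit Types (d : D) (t u : tree) (s : seq (A * tree)) (a b c p q : A).

(* t and t' differ by a permutation of the subtrees at one vertex. *)
Inductive tree_perm : tree -> tree -> Prop :=
| tree_perm_root d s s' : perm_eq s s' -> tree_perm (Node d s) (Node d s')
| tree_perm_child d s1 s2 a t t' : tree_perm t t' ->
    tree_perm (Node d (s1 ++ (a, t) :: s2)) (Node d (s1 ++ (a, t') :: s2)).

(* t, t1, t2 only differ by the type of one edge, which is k *: a1 + a2 in t,
   a1 in t1 and a2 in t2. *)
Inductive tree_lin (k : K) : tree -> tree -> tree -> Prop :=
| tree_lin_root d s1 s2 a1 a2 t :
    tree_lin k (Node d (s1 ++ (k *: a1 + a2, t) :: s2))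
      (Node d (s1 ++ (a1, t) :: s2)) (Node d (s1 ++ (a2, t) :: s2))
| tree_lin_child d s1 s2 a t t1 t2 : tree_lin k t t1 t2 ->
    tree_lin k (Node d (s1 ++ (a, t) :: s2))
      (Node d (s1 ++ (a, t1) :: s2)) (Node d (s1 ++ (a, t2) :: s2)).

Inductive tree_rel : {freeg tree / K} -> Prop :=
| tree_rel_perm t t' : tree_perm t t' -> tree_rel (<< t >> - << t' >>)
| tree_rel_lin k t t1 t2 : tree_lin k t t1 t2 ->
    tree_rel (<< t >> - (k *: << t1 >> + << t2 >>)).

(* The space g_{A,D} of A-typed D-decorated rooted trees. *)
Definition gtree : Type := pres tree_rel.

HB.instance Definition _ := GRing.Lmodule.on gtree.

Definition cls (t : tree) : gtree := gen t.

Definition clss (s : seq (A * tree)) : seq (A * gtree) :=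
  [seq (e.1, cls e.2) | e <- s].

Fixpoint graft_root_rec d (acc : seq (A * tree)) (r : seq (A * gtree)) : gtree :=
  if r is e :: r' then
    lext (fun t => graft_root_rec d (rcons acc (e.1, t)) r') e.2
  else cls (Node d acc).

(* B_d(a_1 T_1, ..., a_k T_k), extended multilinearly to T_i in gtree. *)
Definition graft_root d (r : seq (A * gtree)) : gtree := graft_root_rec d [::] r.

Variable Phi : {linear tens A A -> tens A A}.

(* The terms of T o_a B_d(a_1 T_1, ..., a_k T_k) where T goes above the i-th
   edge, rec standing for T o_q t_i. The edges are visited from left to right,
   pre being those already visited. *)
Definition circ_edges d (rec : tree -> A -> gtree) (a : A) :=
  fix loop (pre : seq (A * gtree)) (s : seq (A * tree)) : gtree :=
    if s is (b, u) :: s' then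
      tlift (fun p q => graft_root d (pre ++ (p, rec u q) :: clss s'))
        (Phi (tensor a b))
      + loop (rcons pre (b, cls u)) s'
    else 0.

Fixpoint circ_tree (T : gtree) (t : tree) (a : A) : gtree :=
  let: Node d s := t in
  graft_root d ((a, T) :: clss s) + circ_edges d (circ_tree T) a [::] s.

Definition circ (a : A) (T x : gtree) : gtree :=
  lext (fun t => circ_tree T t a) x.

Lemma ttree_ind_mem (P : tree -> Prop) :
  (forall d s, (forall e, e \in s -> P e.2) -> P (Node d s)) -> forall t, P t.
Proof.
move=> IH; fix rec 1 => -[d s]; apply: IH.
elim: s => [|[a t] s IHs] e; first discriminate.
rewrite in_cons => /orP[/eqP->|es]; [exact: (rec t) | exact: IHs es].
Qed.

Lemma cls_perm t t' : tree_perm t t' -> cls t = cls t'.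
Proof.
by move=> tt'; apply/quotsp_eqP/mem_span/tree_rel_perm.
Qed.

Lemma cls_lin k t t1 t2 : tree_lin k t t1 t2 -> cls t = k *: cls t1 + cls t2.
Proof.
move=> tt; rewrite /cls /gen.
have <- := @quotsp_pi_linear K _ tree_rel.
by apply/quotsp_eqP/mem_span/tree_rel_lin.
Qed.

Lemma fglift_tree_rel (V : lmodType K) (f : tree -> V) :
  (forall t t', tree_perm t t' -> f t = f t') ->
  (forall k t t1 t2, tree_lin k t t1 t2 -> f t = k *: f t1 + f t2) ->
  forall E, tree_rel E -> fglift f E = 0.
Proof.
move=> fp fl E.
have fN G F : fglift f (G - F) = fglift f G - fglift f F.
  exact: lift_is_additive.
case=> [t t' tt'|k t t1 t2 tt]; rewrite fN ?fglift_linear !fgliftU.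
  by rewrite (fp _ _ tt') subrr.
by rewrite (fl _ _ _ _ tt) subrr.
Qed.

Lemma graft_root_rec_congr d acc acc' r :
  (forall s, cls (Node d (acc ++ s)) = cls (Node d (acc' ++ s))) ->
  graft_root_rec d acc r = graft_root_rec d acc' r.
Proof.
elim: r acc acc' => [|e r IH] acc acc' E /=; first by have := E [::]; rewrite !cats0.
by apply: eq_lext => t; apply: IH => s; rewrite !cat_rcons.
Qed.

Lemma graft_root_rec_lin k d acc acc1 acc2 r :
  (forall s, cls (Node d (acc ++ s)) =
     k *: cls (Node d (acc1 ++ s)) + cls (Node d (acc2 ++ s))) ->
  graft_root_rec d acc r =
    k *: graft_root_rec d acc1 r + graft_root_rec d acc2 r.
Proof.
elim: r acc acc1 acc2 => [|e r IH] acc acc1 acc2 E /=.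
  by have := E [::]; rewrite !cats0.
rewrite -lext_add; apply: eq_lext => t; apply: IH => s.
by rewrite !cat_rcons.
Qed.

Let rec_rel d acc a r E : tree_rel E ->
  fglift (fun t => graft_root_rec d (rcons acc (a, t)) r) E = 0.
Proof.
apply: fglift_tree_rel => [t t' tt'|k t t1 t2 tt].
  apply: graft_root_rec_congr => s; rewrite !cat_rcons.
  by apply: cls_perm; apply: tree_perm_child.
apply: graft_root_rec_lin => s; rewrite !cat_rcons.
by apply: cls_lin; apply: tree_lin_child.
Qed.

Lemma graft_root_rec_cls d acc s r :
  graft_root_rec d acc (clss s ++ r) = graft_root_rec d (acc ++ s) r.
Proof.
elim: s acc => [|[a t] s IH] acc /=; first by rewrite cats0.
by rewrite lext_gen ?IH ?cat_rcons //; apply: rec_rel.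
Qed.

Lemma graft_root_cls d s : graft_root d (clss s) = cls (Node d s).
Proof. by rewrite -[clss s]cats0 /graft_root graft_root_rec_cls. Qed.

Lemma graft_root_rec_linr d acc r1 r2 a :
  linear (fun T => graft_root_rec d acc (r1 ++ (a, T) :: r2)).
Proof.
move=> k T T'; elim: r1 acc => [|e r1 IH] acc /=.
  by apply: lext_linear; apply: rec_rel.
by rewrite -lext_add; apply: eq_lext => t; rewrite IH.
Qed.

Lemma graft_root_rec_linl d acc r1 r2 T :
  linear (fun a => graft_root_rec d acc (r1 ++ (a, T) :: r2)).
Proof.
move=> k a a'; elim: r1 acc => [|e r1 IH] acc /=.
  rewrite -lext_add; apply: eq_lext => t; apply: graft_root_rec_lin => s.
  by rewrite !cat_rcons; apply/cls_lin/tree_lin_root.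
by rewrite -lext_add; apply: eq_lext => t; rewrite IH.
Qed.

Lemma graft_root_linr d r1 r2 a :
  linear (fun T => graft_root d (r1 ++ (a, T) :: r2)).
Proof. exact: graft_root_rec_linr. Qed.

Lemma graft_root_linl d r1 r2 T :
  linear (fun a => graft_root d (r1 ++ (a, T) :: r2)).
Proof. exact: graft_root_rec_linl. Qed.

Let linear0E (V W : lmodType K) (f : V -> W) : linear f -> f 0 = 0.
Proof. by move=> fl; have := fl (-1) 0 0; rewrite !scaleN1r !addNr. Qed.

Let linear_eq (V : lmodType K) (f g : gtree -> V) :
  linear f -> linear g -> (forall t, f (cls t) = g (cls t)) -> f =1 g.
Proof.
move=> fl gl fg; apply: gen_ind => [|k t u IH]; first by rewrite !linear0E.
by rewrite fl gl IH fg.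
Qed.

Lemma graft_root_swap d r1 r2 e e' :
  graft_root d (r1 ++ e :: e' :: r2) = graft_root d (r1 ++ e' :: e :: r2).
Proof.
rewrite /graft_root; elim: r1 [::] => [|e1 r1 IH] acc; last first.
  by apply: eq_lext => t; exact: IH.
case: e e' => [a T] [a' T'].
move: T; apply: linear_eq => [||t].
- exact: (graft_root_rec_linr d acc [::]).
- exact: (graft_root_rec_linr d acc [:: (a', T')]).
move: T'; apply: linear_eq => [||t'].
- exact: (graft_root_rec_linr d acc [:: (a, cls t)]).
- exact: (graft_root_rec_linr d acc [::]).
apply: (etrans (graft_root_rec_cls d acc [:: (a, t); (a', t')] r2)).
apply: (etrans _ (esym (graft_root_rec_cls d acc [:: (a', t'); (a, t)] r2))).
apply: graft_root_rec_congr => s; apply/cls_perm/tree_perm_root.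
by rewrite perm_cat2r perm_cat2l (perm_catC [:: (a, t)] [:: (a', t')]).
Qed.

Lemma graft_root_perm d r r' :
  perm_eq r r' -> graft_root d r = graft_root d r'.
Proof.
have front l e r0 : graft_root d (l ++ e :: r0) = graft_root d (e :: l ++ r0).
  elim/last_ind: l r0 => [|l x IH] r0 //.
  by rewrite cat_rcons graft_root_swap IH cat_rcons.
suff H l : perm_eq r r' -> graft_root d (l ++ r) = graft_root d (l ++ r').
  exact: (H [::]).
elim: r r' l => [|e r IH] r' l.
  by move=> /perm_size; case: r'.
move=> p; have er' : e \in r' by rewrite -(perm_mem p) mem_head.
case/splitPr: er' p => r1 r2.
rewrite (perm_sym (e :: r)) -cat1s perm_catCA /= perm_cons perm_sym => /IH H.
rewrite -cat_rcons H cat_rcons.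
apply: (etrans (front _ _ _)); rewrite [in RHS]catA; apply: esym.
by apply: (etrans (front _ _ _)); rewrite catA.
Qed.

Let grl d r T : linear (fun p => graft_root d ((p, T) :: r)).
Proof. exact: (graft_root_linl d [::]). Qed.

Let grr d r p : linear (fun T => graft_root d ((p, T) :: r)).
Proof. exact: (graft_root_linr d [::]). Qed.

Lemma circ_edgesE d rec a pre s :
  circ_edges d rec a pre s = \sum_(e <- s)
    tlift (fun p q => graft_root d ((p, rec e.2 q) :: pre ++ clss (rem e s)))
      (Phi (tensor a e.1)).
Proof.
elim: s pre => [|[b u] s IH] pre; first by rewrite big_nil.
rewrite big_cons /= eqxx; congr (_ + _).
  apply: eq_tlift => p q; apply: graft_root_perm.
  by rewrite -cat1s perm_catCA.
rewrite IH; apply: eq_big_seq => e es; apply: eq_tlift => p q.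
apply: graft_root_perm; rewrite perm_cons cat_rcons perm_cat2l.
rewrite -[(b, cls u) :: _]/(clss ((b, u) :: rem e s)).
apply: perm_map => /=; case: ((b, u) =P e) => [->|_] //.
by rewrite perm_sym perm_to_rem.
Qed.

Lemma circ_treeE T d s a : circ_tree T (Node d s) a =
  graft_root d ((a, T) :: clss s) + \sum_(e <- s)
    tlift (fun p q => graft_root d ((p, circ_tree T e.2 q) :: clss (rem e s)))
      (Phi (tensor a e.1)).
Proof. by rewrite /= circ_edgesE. Qed.

Lemma circ_tree_linear_type T t : linear (circ_tree T t).
Proof.
elim/ttree_ind_mem: t => d s IH k a a'.
rewrite !circ_treeE grl scalerDr addrACA; congr (_ + _).
rewrite scaler_sumr -big_split; apply: eq_big_seq => e es /=.
rewrite tensor_linl linearP /=; apply: tlift_linear => [w | v] l x y.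
  exact: grl.
by rewrite (IH _ es) grr.
Qed.

Lemma circ_tree_linear_l t a : linear (fun T => circ_tree T t a).
Proof.
elim/ttree_ind_mem: t a => d s IH a k T T'.
rewrite !circ_treeE grr scalerDr addrACA; congr (_ + _).
rewrite scaler_sumr -big_split; apply: eq_big_seq => e es /=.
by rewrite -tlift_add; apply: eq_tlift => p q; rewrite (IH _ es) grr.
Qed.

Let circ_edge_linear T u d r a :
  linear (fun b => tlift (fun p q => graft_root d ((p, circ_tree T u q) :: r))
    (Phi (tensor a b))).
Proof.
move=> k b b'; rewrite tensor_linr linearP /=.
apply: tlift_linear => [w|v] l x y; first exact: grl.
by rewrite circ_tree_linear_type grr.
Qed.

Lemma circ_tree_perm_root T d s s' a :
  perm_eq s s' -> circ_tree T (Node d s) a = circ_tree T (Node d s') a.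
Proof.
move=> ss'; rewrite !circ_treeE; congr (_ + _).
  by apply: graft_root_perm; rewrite perm_cons perm_map.
rewrite (perm_big _ ss') /=; apply: eq_big_seq => e es.
apply: eq_tlift => p q; apply: graft_root_perm.
rewrite perm_cons perm_map //.
rewrite -(perm_cons e); apply: perm_trans (perm_to_rem es).
rewrite perm_sym; apply: perm_trans (perm_to_rem _); last first.
  by rewrite (perm_mem ss').
by rewrite perm_sym.
Qed.

(* The edge (b, t) of the root is singled out. *)
Let circ_tree_consE T d b t s a : circ_tree T (Node d ((b, t) :: s)) a =
  graft_root d ((a, T) :: (b, cls t) :: clss s) +
  (tlift (fun p q => graft_root d ((p, circ_tree T t q) :: clss s))
     (Phi (tensor a b)) +
   \sum_(e <- s) tlift (fun p q => graft_root d
     ((p, circ_tree T e.2 q) :: (b, cls t) :: clss (rem e s)))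
      (Phi (tensor a e.1))).
Proof. by rewrite /= circ_edgesE. Qed.

Let grl2 d e r T : linear (fun p => graft_root d (e :: (p, T) :: r)).
Proof. exact: (graft_root_linl d [:: e]). Qed.

Let grr2 d e r p : linear (fun T => graft_root d (e :: (p, T) :: r)).
Proof. exact: (graft_root_linr d [:: e]). Qed.

Let circ_rel T a E : tree_rel E -> fglift (fun t => circ_tree T t a) E = 0.
Proof.
have mid d s1 s2 b t c : circ_tree T (Node d (s1 ++ (b, t) :: s2)) c =
    circ_tree T (Node d ((b, t) :: s1 ++ s2)) c.
  by apply: circ_tree_perm_root; rewrite -cat1s perm_catCA.
apply: fglift_tree_rel => [t t' tt'|k t t1 t2 tt].
  elim: tt' a => {t t'} [d s s' ss'|d s1 s2 b t t' tt' IH] a.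
    exact: circ_tree_perm_root.
  rewrite !mid !circ_tree_consE (cls_perm tt'); congr (_ + (_ + _)).
  by apply: eq_tlift => p q; rewrite IH.
elim: tt a => {t t1 t2} [d s1 s2 a1 a2 t|d s1 s2 b t t1 t2 tt IH] a.
  rewrite !mid !circ_tree_consE grl2 circ_edge_linear !scalerDr.
  rewrite [RHS]addrACA [X in _ = _ + X]addrACA; congr (_ + (_ + _)).
  rewrite scaler_sumr -big_split; apply: eq_bigr => e _ /=.
  by rewrite -tlift_add; apply: eq_tlift => p q; rewrite grl2.
rewrite !mid !circ_tree_consE (cls_lin tt) grr2 !scalerDr.
rewrite [RHS]addrACA [X in _ = _ + X]addrACA; congr (_ + (_ + _)).
  by rewrite -tlift_add; apply: eq_tlift => p q; rewrite IH grr.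
rewrite scaler_sumr -big_split; apply: eq_bigr => e _ /=.
by rewrite -tlift_add; apply: eq_tlift => p q; rewrite grr2.
Qed.

Lemma circ_linear_l a x : linear (fun T => circ a T x).
Proof.
move=> k T T'; rewrite /circ -lext_add; apply: eq_lext => t.
exact: circ_tree_linear_l.
Qed.

Lemma circ_linear_r a T : linear (circ a T).
Proof. exact: lext_linear (@circ_rel T a). Qed.

Lemma circ_cls a T t : circ a T (cls t) = circ_tree T t a.
Proof. exact: lext_gen (@circ_rel T a) t. Qed.

(* The inductive definition of T o_a B_d(a_1 T_1, ..., a_k T_k). *)
Lemma circ_node a T d s : circ a T (cls (Node d s)) =
  graft_root d ((a, T) :: clss s) + \sum_(e <- s)
    tlift (fun p q => graft_root d ((p, circ q T (cls e.2)) :: clss (rem e s)))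
      (Phi (tensor a e.1)).
Proof.
rewrite circ_cls circ_treeE; congr (_ + _); apply: eq_bigr => e _.
by apply: eq_tlift => p q; rewrite circ_cls.
Qed.

End Trees.

Section PreLie.
Variable K : fieldType.
Implicit Types L M : lmodType K.

(* (L, m) is a left pre-Lie algebra. *)
Definition is_prelie L (m : L -> L -> L) : Prop :=
  [/\ forall y, linear (m^~ y), forall x, linear (m x)
    & forall x y z, m x (m y z) - m (m x y) z = m y (m x z) - m (m y x) z].

(* The pre-Lie algebra (L, m) is freely generated by its subspace V. A linear
   map V -> M is represented by a map on L, of which only the values on V
   matter. *)
Definition freely_generated L (m : L -> L -> L) (V : {pred L}) : Prop :=
  is_prelie m /\
  forall M (n : M -> M -> M), is_prelie n ->
  forall phi : L -> M,
    (forall k, {in V &, forall u v, phi (k *: u + v) = k *: phi u + phi v}) ->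
  exists F : {linear L -> M},
    [/\ {morph F : x y / m x y >-> n x y}, {in V, F =1 phi}
      & forall G : {linear L -> M},
          {morph G : x y / m x y >-> n x y} -> {in V, G =1 phi} -> G =1 F].

End PreLie.

Section RootKer.
Variables (K : fieldType) (A : lmodType K) (D : Type) (f : {scalar A}).

Definition root_in_ker (t : ttree A D) : Prop :=
  let: Node _ s := t in forall e, e \in s -> f e.1 = 0.

(* The span of the trees all of whose root edges have their type in ker f. *)
Definition root_ker_space : {pred gtree A D} :=
  span (fun x => exists2 t, root_in_ker t & x = cls t).

End RootKer.

Arguments root_ker_space {K A} D f.

(* Main.v *)
(* Every edge type splits as c = f c *: a + c' with f c' = 0.  Grafting T on the
   root of x by an edge of type a is the product T o_a x minus the terms in
   which T sits higher in x; the latter have as many vertices as the grafted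
   tree but one root edge less.  So, by induction on the pair (number of
   vertices, number of root edges), a pre-Lie morphism is determined by its
   values on the trees with root edges typed in ker f, and these values may be
   prescribed: expanding the root edges from left to right gives a formula for
   the morphism which does not depend on the order of the edges because both
   products are left pre-Lie. *)

Require Import Defs.
From HB Require Import structures.
From mathcomp Require Import all_boot all_algebra zify.
From mathcomp Require Import freeg.

Set Implicit Arguments.
Unset Strict Implicit.
Unset Printing Implicit Defensive.

Import GRing.Theory.
Local Open Scope ring_scope.

Local Notation span := Defs.span.

(** * Linear maps against linear extensions, spans and tensors *)

Section LinearProp.
Variables (K : fieldType) (U V : lmodType K) (h : U -> V).
Hypothesis hl : linear h.

Let hL : {linear U -> V} := HB.pack h (GRing.isLinear.Build K U V *:%R h hl).

Lemma lin0 : h 0 = 0. Proof. exact: (linear0 hL). Qed.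
Lemma linD x y : h (x + y) = h x + h y. Proof. exact: (linearD hL). Qed.
Lemma linB x y : h (x - y) = h x - h y. Proof. exact: (linearB hL). Qed.
Lemma linZ k x : h (k *: x) = k *: h x.
Proof. by rewrite -[k *: x]addr0 hl lin0 addr0. Qed.
Lemma lin_sum I (r : seq I) (F : I -> U) :
  h (\sum_(i <- r) F i) = \sum_(i <- r) h (F i).
Proof. exact: (linear_sum hL). Qed.

(** [lext f u] is a finite linear combination of values of [f], read off a chosen representative of
    [u], and [h] commutes with such combinations. *)
Lemma lext_comp (X : choiceType) (rel : {freeg X / K} -> Prop) (f : X -> U)
    (u : pres rel) :
  h (lext f u) = lext (fun x => h (f x)) u.
Proof.
rewrite /lext !fglift_sumE lin_sum; apply: eq_bigr => x _; exact: linZ.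
Qed.

Lemma tlift_comp (A B : lmodType K) (f : A -> B -> U) (t : tens A B) :
  h (tlift f t) = tlift (fun x y => h (f x y)) t.
Proof. exact: lext_comp. Qed.

End LinearProp.

Section LinearExtensionality.
Variables (K : fieldType) (V : lmodType K).

Lemma span_linear_eq (U : lmodType K) (g h : U -> V) (S : U -> Prop) :
  linear g -> linear h ->
  (forall x, S x -> g x = h x) -> {in span S, g =1 h}.
Proof.
move=> gl hl gh u /in_spanP; elim=> [|k x y /gh ghx _ IH].
  by rewrite !lin0.
by rewrite hl gl IH ghx.
Qed.

Lemma span_linear_sub (U : lmodType K) (g : U -> V) (S : U -> Prop)
    (S' : V -> Prop) :
  linear g -> (forall x, S x -> g x \in span S') ->
  {in span S, forall u, g u \in span S'}.
Proof.
move=> gl gS u /in_spanP; elim=> [|k x y /gS gx _ IH].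
  by rewrite lin0 // span0.
by rewrite gl span_lin.
Qed.

Lemma gtree_linear_eq (A : lmodType K) (D : Type) (g h : gtree A D -> V) :
  linear g -> linear h -> (forall t, g (cls t) = h (cls t)) -> g =1 h.
Proof.
move=> gl hl gh; apply: gen_ind => [|k t u IH]; first by rewrite !lin0.
by rewrite gl hl IH gh.
Qed.

Lemma tens_linear_eq (U W : lmodType K) (g h : tens U W -> V) :
  linear g -> linear h -> (forall x y, g (tensor x y) = h (tensor x y)) ->
  g =1 h.
Proof.
move=> gl hl gh; apply: gen_ind => [|k [x y] u IH]; first by rewrite !lin0.
by rewrite gl hl IH gh.
Qed.

Lemma tlift_mem (U W : lmodType K) (f : U -> W -> V) (S : V -> Prop) t :
  (forall x y, f x y \in span S) -> tlift f t \in span S.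
Proof.
move=> fS; rewrite /tlift /lext fglift_sumE.
by apply: rpred_sum => -[x y] _; apply: spanZ; apply: fS.
Qed.

Lemma tliftD (U W : lmodType K) (f g : U -> W -> V) t :
  tlift (fun x y => f x y + g x y) t = tlift f t + tlift g t.
Proof.
rewrite -[tlift f t]scale1r -tlift_add; apply: eq_tlift => x y.
by rewrite scale1r.
Qed.

End LinearExtensionality.

(** * Grafting on the root, and the remaining terms of the product *)

Section Graft.
Variables (K : fieldType) (A : lmodType K) (D : Type).
Local Notation tree := (ttree A D).
Local Notation g := (gtree A D).
Implicit Types (b c p q : A) (T U X Y Z x : g) (d : D) (t u : tree).

(** Turns the addition of one root edge into an operation on [gtree], linear in all three arguments,
    so that identities can be proved by induction on the number of root edges. *)
Definition graft c T x : g :=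
  lext (fun t => let: Node d s := t in graft_root d ((c, T) :: clss s)) x.

Let graft_rel c T E : tree_rel E -> fglift
  (fun t => let: Node d s := t in graft_root d ((c, T) :: clss s)) E = 0.
Proof.
apply: fglift_tree_rel => [_ _ [d s s' ss'|d s1 s2 b t t' tt']|].
- by apply: graft_root_perm; rewrite perm_cons perm_map.
- by rewrite /clss !map_cat /= (cls_perm tt').
move=> k _ _ _ [d s1 s2 a1 a2 t|d s1 s2 b t t1 t2 tt].
  by rewrite /clss !map_cat /= -cat_cons graft_root_linl.
by rewrite /clss !map_cat /= (cls_lin tt) -cat_cons graft_root_linr.
Qed.

Lemma graft_node c T d s :
  graft c T (cls (Node d s)) = graft_root d ((c, T) :: clss s).
Proof. exact: (lext_gen (@graft_rel c T)). Qed.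

Lemma graft_cls c t d s :
  graft c (cls t) (cls (Node d s)) = cls (Node d ((c, t) :: s)).
Proof. by rewrite graft_node -graft_root_cls. Qed.

Lemma graft_linear_r c T : linear (graft c T).
Proof. exact: (lext_linear (@graft_rel c T)). Qed.

Lemma graft_linear_l c x : linear (fun T => graft c T x).
Proof.
move=> k T T'; rewrite /graft -lext_add; apply: eq_lext => -[d s].
exact: (graft_root_linr d [::]).
Qed.

Lemma graft_linear_type T x : linear (fun c => graft c T x).
Proof.
move=> k c c'; rewrite /graft -lext_add; apply: eq_lext => -[d s].
exact: (graft_root_linl d [::]).
Qed.

Lemma graftC b c T U x : graft b T (graft c U x) = graft c U (graft b T x).
Proof.
move: T; apply: gtree_linear_eq => [||t]; first exact: graft_linear_l.
  by move=> k T T'; rewrite graft_linear_l graft_linear_r.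
move: U; apply: gtree_linear_eq => [||u]; last first.
- move: x; apply: gtree_linear_eq => [k y z|k y z|[d s]].
  + by rewrite !graft_linear_r.
  + by rewrite !graft_linear_r.
  rewrite !graft_cls; apply/cls_perm/tree_perm_root.
  exact: (permEl (perm_catCA [:: (b, t)] [:: (c, u)] s)).
- exact: graft_linear_l.
by move=> k T T'; rewrite graft_linear_l graft_linear_r.
Qed.

Lemma graft_graft_root c T d r :
  graft c T (graft_root d r) = graft_root d ((c, T) :: r).
Proof.
move: T; apply: gtree_linear_eq => [||t]; first exact: graft_linear_l.
  exact: (graft_root_linr d [::]).
rewrite -[(c, cls t) :: r]/(clss [:: (c, t)] ++ r).
rewrite [RHS](graft_root_rec_cls d [::] [:: (c, t)] r).
rewrite /graft_root /= -[[:: (c, t)]]/((c, t) :: [::]).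
elim: r [::] => [|e r IH] acc /=; first exact: graft_cls.
by rewrite (lext_comp (graft_linear_r c (cls t))); apply: eq_lext => u.
Qed.

Variable Phi : {linear tens A A -> tens A A}.

Lemma circ_linear_type T x : linear (fun b => circ Phi b T x).
Proof.
move=> k b b'; rewrite /circ -lext_add; apply: eq_lext => t.
exact: circ_tree_linear_type.
Qed.

(* The terms of T o_b x in which T is not grafted on the root. *)
Definition delta b T x : g := circ Phi b T x - graft b T x.

Lemma circE b T x : circ Phi b T x = graft b T x + delta b T x.
Proof. by rewrite addrC subrK. Qed.

Lemma delta_linear_r b T : linear (delta b T).
Proof.
move=> k x y; rewrite /delta circ_linear_r graft_linear_r.
by rewrite scalerBr opprD addrACA.
Qed.

Lemma delta_linear_l b x : linear (fun T => delta b T x).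
Proof.
move=> k T U; rewrite /delta circ_linear_l graft_linear_l.
by rewrite scalerBr opprD addrACA.
Qed.

Lemma delta_linear_type T x : linear (fun b => delta b T x).
Proof.
move=> k b c; rewrite /delta circ_linear_type graft_linear_type.
by rewrite scalerBr opprD addrACA.
Qed.

Lemma delta_leaf b T d : delta b T (cls (Node d [::])) = 0.
Proof. by rewrite /delta circ_node big_nil addr0 graft_node subrr. Qed.

Lemma graft_circ_linear_type T U x p :
  linear (fun q => graft p (circ Phi q T U) x).
Proof. by move=> k q q'; rewrite circ_linear_type graft_linear_l. Qed.

(** In a term of [delta], [T] goes either above a root edge of [x] or above the new edge of type
    [c]; in the second case [Phi] changes the type of that edge and of the product taken inside
    [U]. *)
Lemma delta_graft b c T U x :
  delta b T (graft c U x) = graft c U (delta b T x) +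
    tlift (fun p q => graft p (circ Phi q T U) x) (Phi (tensor b c)).
Proof.
move: U; apply: gtree_linear_eq => [k U U'|k U U'|u].
- by rewrite graft_linear_l delta_linear_r.
- rewrite graft_linear_l scalerDr addrACA -tlift_add; congr (_ + _).
  by apply: eq_tlift => p q; rewrite circ_linear_r graft_linear_l.
move: x; apply: gtree_linear_eq => [k x y|k x y|[d s]].
- by rewrite graft_linear_r delta_linear_r.
- rewrite delta_linear_r graft_linear_r scalerDr addrACA -tlift_add.
  by congr (_ + _); apply: eq_tlift => p q; rewrite graft_linear_r.
rewrite graft_cls {1}/delta circ_cls /= circ_edgesE graft_node.
rewrite addrC addKr addrC; congr (_ + _).
  rewrite /delta circ_node graft_node addrC addKr.
  rewrite (lin_sum (graft_linear_r c (cls u))); apply: eq_bigr => e _.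
  rewrite (tlift_comp (graft_linear_r c (cls u))); apply: eq_tlift => p q.
  rewrite graft_graft_root circ_cls; apply: graft_root_perm.
  by rewrite -cat1s perm_catCA.
by apply: eq_tlift => p q; rewrite circ_cls graft_node.
Qed.

End Graft.

Section LinearCombinators.
Variables (K : fieldType) (U V W X : lmodType K).

Lemma comp_linear (g : V -> W) (h : U -> V) :
  linear g -> linear h -> linear (fun x => g (h x)).
Proof. by move=> gl hl k x y; rewrite hl gl. Qed.

Lemma tlift_param_linear (f : X -> U -> V -> W) t :
  (forall u v, linear (fun x => f x u v)) -> linear (fun x => tlift (f x) t).
Proof.
move=> fl k x y; rewrite -tlift_add; apply: eq_tlift => u v; exact: fl.
Qed.

End LinearCombinators.

(** * Trilinear maps and the two axioms of an lCEDS *)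

Section ThreefoldTensor.
Variables (K : fieldType) (U : lmodType K).

Lemma tassoc_linear (V1 V2 V3 : lmodType K) : linear (@tassoc K V1 V2 V3).
Proof.
apply: tlift_linear => [z|t].
  apply: tlift_linear => [v|u]; first exact: tensor_linl.
  exact: (comp_linear (@tensor_linr _ _ _ u) (@tensor_linl _ _ _ z)).
apply: tlift_param_linear => u v.
exact: (comp_linear (@tensor_linr _ _ _ u) (@tensor_linr _ _ _ v)).
Qed.

Lemma tassocV_linear (V1 V2 V3 : lmodType K) : linear (@tassocV K V1 V2 V3).
Proof.
apply: tlift_linear => [t|u].
  apply: tlift_param_linear => v w.
  exact: (comp_linear (@tensor_linl _ _ _ w) (@tensor_linl _ _ _ v)).
apply: tlift_linear => [w|v]; last exact: tensor_linr.
exact: (comp_linear (@tensor_linl _ _ _ w) (@tensor_linr _ _ _ u)).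
Qed.

Variable A : lmodType K.
Implicit Types (x y z : A) (h : A -> A -> A -> U) (F : tens A A -> tens A A).

Definition trilinear h : Prop :=
  [/\ forall y z, linear (fun x => h x y z),
      forall x z, linear (fun y => h x y z)
    & forall x y, linear (h x y)].

Definition tlift3 h (t : tens A (tens A A)) : U :=
  tlift (fun x s => tlift (h x) s) t.

Lemma tlift3_linear h : trilinear h -> linear (tlift3 h).
Proof.
case=> h1 h2 h3; apply: tlift_linear => [s|x]; last exact: tlift_linear.
exact: tlift_param_linear.
Qed.

Lemma tlift3_tensor h x t :
  trilinear h -> tlift3 h (tensor x t) = tlift (h x) t.
Proof.
case=> h1 h2 h3.
apply: (tlift_tensor (f := fun x s => tlift (h x) s)) => [s|y].
  exact: tlift_param_linear.
exact: tlift_linear.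
Qed.

Lemma tlift3_tensor3 h x y z :
  trilinear h -> tlift3 h (tensor x (tensor y z)) = h x y z.
Proof.
by move=> hh; rewrite tlift3_tensor // tlift_tensor //; case: hh.
Qed.

(** [lift12 F] and [lift23 F] are the transposes of [act12 F] and [act23 F] on trilinear maps: a
    composite of actions under [tlift3] is unfolded starting from the outermost one. *)
Definition lift12 F h x y z : U := tlift (fun p q => h p q z) (F (tensor x y)).
Definition lift23 F h x y z : U := tlift (h x) (F (tensor y z)).

Lemma lift12_trilinear F h : linear F -> trilinear h -> trilinear (lift12 F h).
Proof.
move=> Fl [h1 h2 h3].
have hl z : linear (tlift (fun p q => h p q z)) by apply: tlift_linear.
split=> [y z|x z|x y].
- exact: (comp_linear (hl z) (comp_linear Fl (@tensor_linl _ _ _ y))).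
- exact: (comp_linear (hl z) (comp_linear Fl (@tensor_linr _ _ _ x))).
exact: tlift_param_linear.
Qed.

Lemma lift23_trilinear F h : linear F -> trilinear h -> trilinear (lift23 F h).
Proof.
move=> Fl [h1 h2 h3].
have hl x : linear (tlift (h x)) by apply: tlift_linear.
split=> [y z|x z|x y].
- exact: tlift_param_linear.
- exact: (comp_linear (hl x) (comp_linear Fl (@tensor_linl _ _ _ z))).
exact: (comp_linear (hl x) (comp_linear Fl (@tensor_linr _ _ _ y))).
Qed.

Lemma tens3_linear_eq (g h : tens A (tens A A) -> U) : linear g -> linear h ->
  (forall x y z, g (tensor x (tensor y z)) = h (tensor x (tensor y z))) ->
  g =1 h.
Proof.
move=> gl hl gh; apply: tens_linear_eq => // x.
apply: tens_linear_eq => //.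
- exact: (comp_linear gl (@tensor_linr _ _ _ x)).
exact: (comp_linear hl (@tensor_linr _ _ _ x)).
Qed.

Lemma act12_linear F : linear F -> linear (act12 F).
Proof.
move=> Fl; have t : linear (tmap F (@idfun A)) by apply: tmap_linear.
have t' := comp_linear t (@tassocV_linear A A A).
exact: (comp_linear (@tassoc_linear A A A) t').
Qed.

Lemma act23_linear F : linear F -> linear (act23 F).
Proof. by move=> Fl; apply: tmap_linear. Qed.

Lemma tlift3_act12 F h t : linear F -> trilinear h ->
  tlift3 h (act12 F t) = tlift3 (lift12 F h) t.
Proof.
move=> Fl hh; have hl := tlift3_linear hh; case: (hh) => h1 h2 h3.
move: t; apply: tens3_linear_eq => [||x y z].
- exact: (comp_linear hl (act12_linear Fl)).
- exact/tlift3_linear/lift12_trilinear.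
rewrite tlift3_tensor3; last exact: lift12_trilinear.
rewrite /act12 /comp tassocV_tensor tmap_tensor // /lift12.
move: (F _); apply: tens_linear_eq => [||p q].
- exact: (comp_linear hl (comp_linear (@tassoc_linear A A A)
    (@tensor_linl _ _ _ z))).
- exact: tlift_linear.
by rewrite tassoc_tensor tlift3_tensor3 // tlift_tensor.
Qed.

Lemma tlift3_act23 F h t : linear F -> trilinear h ->
  tlift3 h (act23 F t) = tlift3 (lift23 F h) t.
Proof.
move=> Fl hh; move: t; apply: tens3_linear_eq => [||x y z].
- exact: (comp_linear (tlift3_linear hh) (act23_linear Fl)).
- exact/tlift3_linear/lift23_trilinear.
rewrite tlift3_tensor3; last exact: lift23_trilinear.
by rewrite /act23 tmap_tensor // tlift3_tensor.
Qed.

Lemma lift12_flip h x y z :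
  trilinear h -> lift12 (@tflip K A A) h x y z = h y x z.
Proof. by case=> h1 h2 h3; rewrite /lift12 tflip_tensor tlift_tensor. Qed.

Lemma lift23_flip h x y z :
  trilinear h -> lift23 (@tflip K A A) h x y z = h x z y.
Proof. by case=> h1 h2 h3; rewrite /lift23 tflip_tensor tlift_tensor. Qed.

Variable Phi : {linear tens A A -> tens A A}.
Hypothesis hPhi : is_lCEDS Phi.

Let Phil : linear Phi. Proof. exact: linearP. Qed.
Let taul : linear (@tflip K A A). Proof. exact: tflip_linear. Qed.

(** The first axiom evaluated at the tensor of [a], [b], [c] and paired with [h]. *)
Lemma lCEDS_braid h a b c : trilinear h ->
  tlift (fun b1 c1 => tlift (fun a2 b2 => tlift (fun v q => h a2 v q)
    (Phi (tensor b2 c1))) (Phi (tensor a b1))) (Phi (tensor b c)) =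
  tlift (fun p q => tlift (fun u v => h u v q)
    (Phi (tensor p c))) (Phi (tensor a b)).
Proof.
move=> hh; have := hPhi.1 (tensor a (tensor b c)) => /= /(congr1 (tlift3 h)).
have l1 := lift23_trilinear Phil hh; have l2 := lift12_trilinear Phil l1.
have l3 := lift23_trilinear Phil l2; have r1 := lift12_trilinear Phil hh.
have r2 := lift23_trilinear taul r1; have r3 := lift12_trilinear Phil r2.
rewrite (tlift3_act23 _ Phil hh) (tlift3_act12 _ Phil l1).
rewrite (tlift3_act23 _ Phil l2) (tlift3_tensor3 _ _ _ l3).
rewrite (tlift3_act12 _ Phil hh) (tlift3_act23 _ taul r1).
rewrite (tlift3_act12 _ Phil r2) (tlift3_tensor3 _ _ _ r3) => E.
by apply: (etrans E); apply: eq_tlift => p q; rewrite lift23_flip.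
Qed.

(** The second axiom evaluated at the tensor of [b], [c], [a]. The flips move the factors around;
    pairing with the cyclic rotation [k] of [h] puts them back in the order used by [h]. *)
Lemma lCEDS_flip h a b c : trilinear h ->
  tlift (fun u v => tlift (fun s t => h s t v)
    (Phi (tensor a u))) (Phi (tensor b c)) =
  tlift (fun u v => tlift (fun s t => h s v t)
    (Phi (tensor b u))) (Phi (tensor a c)).
Proof.
move=> hh; pose k x y z := h y z x.
have kk : trilinear k.
  by case: hh => h1 h2 h3; split=> [y z|x z|x y]; rewrite /k.
have := hPhi.2 (tensor b (tensor c a)) => /= /(congr1 (tlift3 k)).
have l1 := lift23_trilinear Phil kk; have l2 := lift23_trilinear taul l1.
have l3 := lift12_trilinear taul l2; have l4 := lift12_trilinear Phil l3.
have r1 := lift12_trilinear taul kk; have r2 := lift12_trilinear Phil r1.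
have r3 := lift23_trilinear Phil r2; have r4 := lift23_trilinear taul r3.
rewrite (tlift3_act23 _ Phil kk) (tlift3_act23 _ taul l1).
rewrite (tlift3_act12 _ taul l2) (tlift3_act12 _ Phil l3).
rewrite (tlift3_tensor3 _ _ _ l4).
rewrite (tlift3_act12 _ taul kk) (tlift3_act12 _ Phil r1).
rewrite (tlift3_act23 _ Phil r2) (tlift3_act23 _ taul r3).
rewrite (tlift3_tensor3 _ _ _ r4) (lift23_flip _ _ _ r3) => E.
transitivity (lift12 Phi (lift12 (@tflip K A A) (lift23 (@tflip K A A)
    (lift23 Phi k))) b c a).
  by apply: eq_tlift => u v; rewrite lift12_flip // lift23_flip.
rewrite E; apply: eq_tlift => u v; apply: eq_tlift => s t.
by rewrite lift12_flip.
Qed.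

End ThreefoldTensor.

(** * The generalized pre-Lie identity for products of all types *)

Section PreLieIdentity.
Variables (K : fieldType) (A : lmodType K) (D : Type).
Variable Phi : {linear tens A A -> tens A A}.
Hypothesis hPhi : is_lCEDS Phi.
Local Notation g := (gtree A D).
Local Notation circ := (circ Phi).
Local Notation delta := (delta Phi).
Implicit Types (b c p q : A) (T U X Y Z x : g).

(* The identity generalizing the left pre-Lie one to products of arbitrary types
   is prelie_assoc b c X Y Z = prelie_assoc c b Y X Z; even when b = c is special
   its proof by induction on Z needs all types. *)
Definition prelie_assoc b c X Y Z : g := circ b X (circ c Y Z) -
  tlift (fun p q => circ p (circ q X Y) Z) (Phi (tensor b c)).

Definition delta_assoc b c X Y x : g := delta b X (delta c Y x) -
  tlift (fun p q => delta p (circ q X Y) x) (Phi (tensor b c)).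

(** The first two summands are visibly invariant under exchanging [(b, X)] with [(c, Y)], the first
    one by [graftC]. The symmetry of [prelie_assoc] thus reduces to that of [delta_assoc]. *)
Lemma prelie_assocE b c X Y Z :
  prelie_assoc b c X Y Z = graft b X (graft c Y Z) +
    (graft b X (delta c Y Z) + graft c Y (delta b X Z)) +
    delta_assoc b c X Y Z.
Proof.
have -> : prelie_assoc b c X Y Z = circ b X (circ c Y Z) -
    (tlift (fun p q => graft p (circ q X Y) Z) (Phi (tensor b c)) +
     tlift (fun p q => delta p (circ q X Y) Z) (Phi (tensor b c))).
  by congr (_ - _); rewrite -tliftD; apply: eq_tlift => p q; apply: circE.
rewrite (circE _ c) (linD (circ_linear_r _ b X)) !(circE _ b).
rewrite delta_graft /delta_assoc [in LHS]opprD.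
(* Summand 3, produced by [delta_graft], cancels summand 6, the grafting part of the subtracted
   sum. *)
rewrite [LHS](AC (((1*2)*2)*2) ((3*6)*((1*(4*2))*(5*7)))).
by rewrite /= subrr add0r.
Qed.

Lemma prelie_assoc_linear_fst c X Y Z :
  linear (fun b => prelie_assoc b c X Y Z).
Proof.
move=> k b b'; rewrite /prelie_assoc circ_linear_type tensor_linl linearP.
rewrite (tlift_linear (f := fun p q => circ p (circ q X Y) Z)) => [|q|p].
- by rewrite scalerBr opprD addrACA.
- exact: circ_linear_type.
by move=> l q q'; rewrite circ_linear_type circ_linear_l.
Qed.

Lemma prelie_assoc_linear_snd b X Y Z :
  linear (fun c => prelie_assoc b c X Y Z).
Proof.
move=> k c c'; rewrite /prelie_assoc circ_linear_type circ_linear_r.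
rewrite tensor_linr linearP.
rewrite (tlift_linear (f := fun p q => circ p (circ q X Y) Z)) => [|q|p].
- by rewrite scalerBr opprD addrACA.
- exact: circ_linear_type.
by move=> l q q'; rewrite circ_linear_type circ_linear_l.
Qed.

(** Two applications of [delta_graft] create products nested inside [U]; the first axiom gives the
    types in both nestings a common form, so that they combine into [prelie_assoc] on the smaller
    argument [U]. *)
Lemma delta_assoc_graft a b c X Y U x :
  delta_assoc a b X Y (graft c U x) = graft c U (delta_assoc a b X Y x) +
   (tlift (fun p q => graft p (circ q X U) (delta b Y x)) (Phi (tensor a c)) +
    tlift (fun p q => graft p (circ q Y U) (delta a X x)) (Phi (tensor b c))) +
   tlift (fun p q => tlift (fun u v => graft u (prelie_assoc v q X Y U) x)
     (Phi (tensor a p))) (Phi (tensor b c)).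
Proof.
have lin_tri : trilinear (fun u v q => graft u (circ v (circ q X Y) U) x).
  split=> [v q|u q|u v] k y z; first exact: graft_linear_type.
    by rewrite circ_linear_type graft_linear_l.
  by rewrite circ_linear_type circ_linear_l graft_linear_l.
have E1 : tlift (fun p q => delta p (circ q X Y) (graft c U x))
      (Phi (tensor a b)) =
    graft c U (tlift (fun p q => delta p (circ q X Y) x) (Phi (tensor a b))) +
    tlift (fun p q => tlift (fun u v => graft u (circ v (circ q X Y) U) x)
      (Phi (tensor p c))) (Phi (tensor a b)).
  rewrite (tlift_comp (graft_linear_r c U)) -tliftD.
  by apply: eq_tlift => p q; apply: delta_graft.
have E2 : delta a X (tlift (fun p q => graft p (circ q Y U) x)
      (Phi (tensor b c))) =
    tlift (fun p q => graft p (circ q Y U) (delta a X x)) (Phi (tensor b c)) +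
    tlift (fun p q => tlift (fun u v => graft u (circ v X (circ q Y U)) x)
      (Phi (tensor a p))) (Phi (tensor b c)).
  rewrite (tlift_comp (delta_linear_r _ a X)) -tliftD.
  by apply: eq_tlift => p q; apply: delta_graft.
have E3 : tlift (fun p q => tlift (fun u v => graft u (circ v X (circ q Y U)) x)
      (Phi (tensor a p))) (Phi (tensor b c)) =
    tlift (fun p q => tlift (fun u v => graft u (prelie_assoc v q X Y U) x)
      (Phi (tensor a p))) (Phi (tensor b c)) +
    tlift (fun p q => tlift (fun u v => graft u (circ v (circ q X Y) U) x)
      (Phi (tensor p c))) (Phi (tensor a b)).
  rewrite -(lCEDS_braid hPhi _ _ _ lin_tri) -tliftD.
  apply: eq_tlift => p q; rewrite -tliftD; apply: eq_tlift => u v.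
  rewrite -(tlift_comp (graft_linear_l u x)) -(linD (graft_linear_l u x)).
  by congr (graft u _ x); rewrite /prelie_assoc subrK.
rewrite {1}/delta_assoc E1 (delta_graft _ b) (linD (delta_linear_r _ a X)).
rewrite E2 E3 (delta_graft _ a) (linB _ (delta a X _)); last first.
  exact: graft_linear_r.
rewrite [in LHS]opprD [LHS](AC ((2*(1*2))*2) (((1*6)*(2*3))*(4*(5*7)))) /=.
by rewrite subrr addr0.
Qed.

Lemma delta_assoc_sym_graft a b c X Y U x :
  (forall b c, prelie_assoc b c X Y U = prelie_assoc c b Y X U) ->
  delta_assoc a b X Y x = delta_assoc b a Y X x ->
  delta_assoc a b X Y (graft c U x) = delta_assoc b a Y X (graft c U x).
Proof.
move=> symU symx; rewrite !delta_assoc_graft symx; congr (_ + _).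
  (* The two middle sums exchange their roles; only the sum over [prelie_assoc] remains, and the
     second axiom handles its types. *)
  by congr (_ + _); apply: addrC.
rewrite (lCEDS_flip hPhi 
  (h := fun u v q => graft u (prelie_assoc v q X Y U) x)).
  apply: eq_tlift => p q; apply: eq_tlift => u v; congr (graft u _ x).
  exact: symU.
split=> [v q|u q|u v] k y z; first exact: graft_linear_type.
  by rewrite prelie_assoc_linear_fst graft_linear_l.
by rewrite prelie_assoc_linear_snd graft_linear_l.
Qed.

Lemma prelie_assoc_sym_delta b c X Y Z :
  delta_assoc b c X Y Z = delta_assoc c b Y X Z ->
  prelie_assoc b c X Y Z = prelie_assoc c b Y X Z.
Proof.
by move=> E; rewrite !prelie_assocE E graftC; congr (_ + _ + _); rewrite addrC.
Qed.

Lemma delta_assoc_linear_r b c X Y : linear (delta_assoc b c X Y).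
Proof.
move=> k x y.
have tl : linear (fun x => tlift (fun p q => delta p (circ q X Y) x)
    (Phi (tensor b c))).
  by apply: tlift_param_linear => p q; apply: delta_linear_r.
rewrite /delta_assoc tl (delta_linear_r _ c Y) (delta_linear_r _ b X).
by rewrite opprD addrACA [in RHS]scalerBr.
Qed.

Lemma delta_assoc_leaf b c X Y d : delta_assoc b c X Y (cls (Node d [::])) = 0.
Proof.
rewrite /delta_assoc delta_leaf (lin0 (delta_linear_r _ b X)) sub0r.
rewrite /tlift /lext fglift_sumE big1 ?oppr0 // => p _.
by rewrite delta_leaf scaler0.
Qed.

(** Induction on subtrees and, inside it, on the list of root edges: the outer hypothesis gives the
    symmetry of [prelie_assoc] on the subtree of the first edge, for all types, and the inner one
    that of [delta_assoc] on the other edges. Both sides vanish on a single vertex. *)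
Lemma delta_assoc_sym b c X Y x : delta_assoc b c X Y x = delta_assoc c b Y X x.
Proof.
move: x; apply: gtree_linear_eq => [||t]; [exact: delta_assoc_linear_r..|].
elim/ttree_ind_mem: t b c => d s IH b c.
elim: s IH => [|[e u] s IHs] IH.
  by rewrite !delta_assoc_leaf.
rewrite -graft_cls; apply: delta_assoc_sym_graft.
  move=> b' c'; apply: prelie_assoc_sym_delta; apply: (IH (e, u)).
  exact: mem_head.
by apply: IHs => f fs; apply: IH; rewrite in_cons fs orbT.
Qed.

(** Since [Phi] fixes the tensor of [a] with itself, the sum over [p], [q] in [delta_assoc] reduces
    to one term, of types [a] and [a]. *)
Lemma delta_assoc1_sym a X Y x : special1 Phi a ->
  delta a X (delta a Y x) - delta a (circ a X Y) x =
  delta a Y (delta a X x) - delta a (circ a Y X) x.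
Proof.
move=> aa; have := delta_assoc_sym a a X Y x; rewrite /delta_assoc aa.
rewrite !tlift_tensor // => [q|p|q|p].
- exact: delta_linear_type.
- by move=> k q q'; rewrite circ_linear_type delta_linear_l.
- exact: delta_linear_type.
- by move=> k q q'; rewrite circ_linear_type delta_linear_l.
Qed.

Lemma circ_prelie a : special1 Phi a -> is_prelie (@Defs.circ K A D Phi a).
Proof.
move=> aa; split; [exact: circ_linear_l | exact: circ_linear_r | move=> X Y Z].
have := prelie_assoc_sym_delta (delta_assoc_sym a a X Y Z).
rewrite /prelie_assoc aa !tlift_tensor // => [q|p|q|p].
- exact: circ_linear_type.
- by move=> k q q'; rewrite circ_linear_type circ_linear_l.
- exact: circ_linear_type.
- by move=> k q q'; rewrite circ_linear_type circ_linear_l.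
Qed.

End PreLieIdentity.

(** * Sizes, arities and ranks of trees *)

Section TreeRank.
Variables (K : fieldType) (A : lmodType K) (D : Type).
Local Notation tree := (ttree A D).
Local Notation g := (gtree A D).
Implicit Types (t u : tree) (x X : g) (m k N : nat).

Fixpoint tree_size t : nat :=
  let: Node _ s := t in (\sum_(i <- [seq tree_size e.2 | e <- s]) i).+1.

Definition arity t : nat := let: Node _ s := t in size s.

(* Since arity t < tree_size t, comparing ranks is comparing the pairs
   (tree_size t, arity t) lexicographically. *)
Definition rank t : nat := (tree_size t * tree_size t + arity t)%N.

Lemma tree_size_node d (s : seq (A * tree)) :
  tree_size (Node d s) = (\sum_(e <- s) tree_size e.2).+1.
Proof. by rewrite /= big_map. Qed.

Lemma tree_size_cons d c u (s : seq (A * tree)) :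
  tree_size (Node d ((c, u) :: s)) = (tree_size u + tree_size (Node d s))%N.
Proof. by rewrite !tree_size_node big_cons addnS. Qed.

Lemma tree_size_gt0 t : (0 < tree_size t)%N. Proof. by case: t. Qed.

Lemma arity_lt t : (arity t < tree_size t)%N.
Proof.
case: t => d s; rewrite tree_size_node ltnS /=.
elim: s => [|e s IH]; first by rewrite big_nil.
by rewrite big_cons /=; have := tree_size_gt0 e.2; lia.
Qed.

Lemma tree_perm_arity t t' : tree_perm t t' -> arity t = arity t'.
Proof.
by case=> [d s s' /perm_size|d s1 s2 b u u' _] //=; rewrite !size_cat.
Qed.

Lemma tree_perm_size t t' : tree_perm t t' -> tree_size t = tree_size t'.
Proof.
elim=> [d s s' ss'|d s1 s2 b u u' _ IH]; rewrite !tree_size_node.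
  by rewrite (perm_big _ ss').
by rewrite !big_cat !big_cons /= IH.
Qed.

Lemma tree_lin_arity (c : K) t t1 t2 : tree_lin c t t1 t2 ->
  arity t1 = arity t /\ arity t2 = arity t.
Proof. by case=> *; rewrite /= !size_cat. Qed.

Lemma tree_lin_size (c : K) t t1 t2 : tree_lin c t t1 t2 ->
  tree_size t1 = tree_size t /\ tree_size t2 = tree_size t.
Proof.
elim=> [d s1 s2 a1 a2 u|d s1 s2 b u u1 u2 _ [IH1 IH2]];
  by rewrite !tree_size_node !big_cat !big_cons /= ?IH1 ?IH2.
Qed.

Lemma tree_perm_rank t t' : tree_perm t t' -> rank t = rank t'.
Proof.
by move=> tt; rewrite /rank (tree_perm_size tt) (tree_perm_arity tt).
Qed.

Lemma tree_lin_rank (c : K) t t1 t2 : tree_lin c t t1 t2 ->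
  rank t1 = rank t /\ rank t2 = rank t.
Proof.
move=> tt; rewrite /rank.
by have [-> ->] := tree_lin_size tt; have [-> ->] := tree_lin_arity tt.
Qed.

(** Products of trees are linear combinations of trees, so sizes, arities and ranks are followed
    through the spans of these three predicates. *)
Definition of_size m x : Prop := exists2 t, tree_size t = m & x = cls t.
Definition of_shape m k x : Prop :=
  exists t, [/\ tree_size t = m, arity t = k & x = cls t].
Definition below N x : Prop := exists2 t, (rank t < N)%N & x = cls t.

Lemma span_sub (S S' : g -> Prop) :
  (forall x, S x -> S' x) -> {in span S, forall x, x \in span S'}.
Proof.
move=> SS'; apply: (span_linear_sub (g := fun x : g => x)) => // x Sx.
by apply/mem_span/SS'.
Qed.

Lemma cls_size t : cls t \in span (of_size (tree_size t)).
Proof. by apply: mem_span; exists t. Qed.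

Lemma cls_shape t : cls t \in span (of_shape (tree_size t) (arity t)).
Proof. by apply: mem_span; exists t. Qed.

Lemma shape_size m k x : x \in span (of_shape m k) -> x \in span (of_size m).
Proof. by apply: span_sub => _ [t [tm _ ->]]; exists t. Qed.

Lemma shape_below N m k x : (m * m + k < N)%N ->
  x \in span (of_shape m k) -> x \in span (below N).
Proof.
move=> mk; apply: span_sub => _ [t [tm tk ->]].
by exists t => //; rewrite /rank tm tk.
Qed.

Lemma graft_shape c X x m m' k :
  X \in span (of_size m) -> x \in span (of_shape m' k) ->
  graft c X x \in span (of_shape (m + m') k.+1).
Proof.
move=> Xm; apply: span_linear_sub; first exact: graft_linear_r.
move=> _ [t [tm tk ->]]; move: X Xm.
apply: span_linear_sub; first exact: graft_linear_l.
move=> _ [u um ->]; apply: mem_span; case: t tm tk => d s tm tk.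
exists (Node d ((c, u) :: s)).
by rewrite tree_size_cons um tm /= -[size s]/(arity (Node d s)) tk graft_cls.
Qed.

Variable Phi : {linear tens A A -> tens A A}.

Let circ_size_tree b X m u : X \in span (of_size m) ->
  delta Phi b X (cls u) \in span (of_shape (m + tree_size u) (arity u)) ->
  circ Phi b X (cls u) \in span (of_size (m + tree_size u)).
Proof.
move=> Xm Xu; rewrite circE rpredD //; last exact: shape_size Xu.
exact: shape_size (graft_shape b Xm (cls_shape u)).
Qed.

Let delta_shape_tree b X m u : X \in span (of_size m) ->
  delta Phi b X (cls u) \in span (of_shape (m + tree_size u) (arity u)).
Proof.
move=> Xm; elim/ttree_ind_mem: u b => d s; elim: s => [|[c u] s IHs] IH b.
  by rewrite delta_leaf rpred0.
have Xs : forall b', delta Phi b' X (cls (Node d s)) \in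
    span (of_shape (m + tree_size (Node d s)) (arity (Node d s))).
  by move=> b'; apply: IHs => f fs; apply: IH; rewrite in_cons fs orbT.
rewrite -graft_cls delta_graft tree_size_cons rpredD //.
  by rewrite addnCA; apply: graft_shape; [exact: cls_size | exact: Xs].
apply: tlift_mem => p q; rewrite addnA; apply: graft_shape (cls_shape _).
by apply: circ_size_tree => //; apply: (IH (c, u)); apply: mem_head.
Qed.

(** Inserting [X] above a root edge adds the sizes but no root edge. Compared with [graft_shape],
    the arity is one less, which makes the induction on the rank possible. *)
Lemma delta_shape b X x m m' k :
  X \in span (of_size m) -> x \in span (of_shape m' k) ->
  delta Phi b X x \in span (of_shape (m + m') k).
Proof.
move=> Xm; apply: span_linear_sub; first exact: delta_linear_r.
by move=> _ [t [<- <- ->]]; apply: delta_shape_tree.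
Qed.

Lemma circ_size b X U m m' :
  X \in span (of_size m) -> U \in span (of_size m') ->
  circ Phi b X U \in span (of_size (m + m')).
Proof.
move=> Xm; apply: span_linear_sub; first exact: circ_linear_r.
move=> _ [t <- ->]; apply: circ_size_tree => //; exact: delta_shape_tree.
Qed.

End TreeRank.

(** Adjacent transpositions bring any entry to the front, and one concludes by induction. The prefix
    [l] makes room for the entries already matched. *)
Lemma perm_eq_swap (T : eqType) (R : Type) (G : seq T -> R) :
  (forall r1 e e' r2, G (r1 ++ e :: e' :: r2) = G (r1 ++ e' :: e :: r2)) ->
  forall s s', perm_eq s s' -> G s = G s'.
Proof.
move=> Gs; have front p l e r0 : G (p ++ l ++ e :: r0) = G (p ++ e :: l ++ r0).
  elim/last_ind: l r0 => [|l x IH] r0 //.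
  by rewrite !cat_rcons -IH catA Gs -catA.
suff H s s' l : perm_eq s s' -> G (l ++ s) = G (l ++ s').
  by move=> s s'; apply: (H s s' [::]).
elim: s s' l => [|e r IH] r' l; first by move=> /perm_size; case: r'.
move=> p; have er' : e \in r' by rewrite -(perm_mem p) mem_head.
case/splitPr: er' p => r1 r2.
rewrite (perm_sym (e :: r)) -cat1s perm_catCA /= perm_cons perm_sym => p.
by rewrite front -!cat_rcons; apply: IH.
Qed.

(** * Expansion of the root edges along [a] and the kernel of [f] *)

Section Telescope.
Variables (K : fieldType) (A : lmodType K) (D : Type).
Local Notation tree := (ttree A D).
Local Notation g := (gtree A D).
Variables (a : A) (f : {scalar A}).
Hypothesis fa : f a = 1.
Implicit Types (c : A) (T X x : g) (d : D) (pre r : seq (A * g)) (t u : tree).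

Definition kproj c : A := c - f c *: a.

Lemma f_kproj c : f (kproj c) = 0.
Proof. by rewrite linearB linearZ /= fa mulr1 subrr. Qed.

Lemma kproj_ker c : f c = 0 -> kproj c = c.
Proof. by rewrite /kproj => ->; rewrite scale0r subr0. Qed.

Lemma kproj_linear : linear kproj.
Proof.
move=> k c c'; rewrite /kproj linearP scalerDl scalerBr scalerA opprD.
by rewrite addrACA.
Qed.

Definition in_ker (r : seq (A * g)) : Prop := forall e, e \in r -> f e.1 = 0.

Lemma graft_root_ker_space d r :
  in_ker r -> graft_root d r \in root_ker_space D f.
Proof.
elim: r => [|[c T] r IH] kr.
  apply: mem_span; exists (Node d [::]) => //.
have fc : f c = 0 by apply: (kr (c, T)); apply: mem_head.
have : graft_root d r \in root_ker_space D f.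
  by apply: IH => e er; apply: kr; rewrite in_cons er orbT.
rewrite -graft_graft_root.
move: (graft_root d r).
apply: span_linear_sub; first exact: graft_linear_r.
move=> _ [[d' s] ks ->]; move: T {kr}.
apply: gen_ind => [|k t T IHT].
  by rewrite (lin0 (graft_linear_l c _)) rpred0.
rewrite graft_linear_l span_lin // graft_cls; apply: mem_span.
exists (Node d' ((c, t) :: s)) => // e.
by rewrite in_cons => /orP[/eqP-> //|]; apply: ks.
Qed.

Variables (M : lmodType K) (phi : g -> M).
Hypothesis phil : forall k,
  {in root_ker_space D f &, forall x y, phi (k *: x + y) = k *: phi x + phi y}.
Variable B : g -> g -> M.
Hypotheses (Bl : forall x, linear (B^~ x)) (Br : forall T, linear (B T)).

(* Writing each type as c = f c *: a + kproj c and expanding the edges from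
   left to right, B_d(pre ++ r) is a sum of trees with a root edge of type a,
   which are sent to M by B, and of a tree with all its root edges typed in
   ker f, which is sent to M by phi. *)
Fixpoint telescope d pre r : M :=
  if r is (c, T) :: r' then
    f c *: B T (graft_root d (pre ++ r')) +
    telescope d (rcons pre (kproj c, T)) r'
  else phi (graft_root d pre).

Lemma telescope_congr d pre pre' r :
  (forall r, graft_root d (pre ++ r) = graft_root d (pre' ++ r)) ->
  telescope d pre r = telescope d pre' r.
Proof.
elim: r pre pre' => [|[c T] r IH] pre pre' E /=.
  by have := E [::]; rewrite !cats0 => ->.
by rewrite E; congr (_ + _); apply: IH => r'; rewrite !cat_rcons.
Qed.

Lemma in_ker_rcons pre c T : in_ker pre -> in_ker (rcons pre (kproj c, T)).
Proof.
move=> kp e; rewrite mem_rcons in_cons => /orP[/eqP->|]; last exact: kp.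
exact: f_kproj.
Qed.

(** The expansion ends with [phi], which is linear on [root_ker_space] only; this is why the
    prefixes have their types in the kernel of [f]. *)
Lemma telescope_lin_pre k d pre pre1 pre2 r :
  in_ker pre1 -> in_ker pre2 ->
  (forall r, graft_root d (pre ++ r) =
     k *: graft_root d (pre1 ++ r) + graft_root d (pre2 ++ r)) ->
  telescope d pre r = k *: telescope d pre1 r + telescope d pre2 r.
Proof.
elim: r pre pre1 pre2 => [|[c T] r IH] pre pre1 pre2 k1 k2 E /=.
  by have := E [::]; rewrite !cats0 => ->; apply: phil;
    apply: graft_root_ker_space.
rewrite E Br !scalerDr !scalerA addrACA.
rewrite (mulrC k); congr (_ + _); apply: IH; try exact: in_ker_rcons.
by move=> r'; rewrite !cat_rcons.
Qed.

Lemma telescope_linr d pre r1 r2 c : in_ker pre ->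
  linear (fun T => telescope d pre (r1 ++ (c, T) :: r2)).
Proof.
move=> kp k T T'; elim: r1 pre kp => [|[c1 T1] r1 IH] pre kp /=.
  rewrite Bl !scalerDr !scalerA addrACA (mulrC k).
  congr (_ + _); apply: telescope_lin_pre; try exact: in_ker_rcons.
  by move=> r; rewrite !cat_rcons graft_root_linr.
rewrite !catA graft_root_linr Br !scalerDr !scalerA.
by rewrite addrACA (mulrC k) IH //; apply: in_ker_rcons.
Qed.

Lemma telescope_linl d pre r1 r2 T : in_ker pre ->
  linear (fun c => telescope d pre (r1 ++ (c, T) :: r2)).
Proof.
move=> kp k c c'; elim: r1 pre kp => [|[c1 T1] r1 IH] pre kp /=.
  rewrite linearP scalerDl scalerDr !scalerA addrACA.
  congr (_ + _); apply: telescope_lin_pre; try exact: in_ker_rcons.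
  by move=> r; rewrite !cat_rcons kproj_linear graft_root_linl.
rewrite !catA graft_root_linl Br !scalerDr !scalerA.
by rewrite addrACA (mulrC k) IH //; apply: in_ker_rcons.
Qed.

Lemma telescope_ker d pre r : in_ker r ->
  telescope d pre r = phi (graft_root d (pre ++ r)).
Proof.
elim: r pre => [|[c T] r IH] pre kr /=; first by rewrite cats0.
have fc : f c = 0 by apply: (kr (c, T)); apply: mem_head.
rewrite fc scale0r add0r kproj_ker // IH ?cat_rcons // => e er.
by apply: kr; rewrite in_cons er orbT.
Qed.

Lemma telescope_a d T r : telescope d [::] ((a, T) :: r) = B T (graft_root d r).
Proof.
rewrite /= fa scale1r -[RHS]addr0; congr (_ + _).
have -> : kproj a = 0 by rewrite /kproj fa scale1r subrr.
have k0 : in_ker [:: (0, T)].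
  by move=> e; rewrite inE => /eqP->; rewrite linear0.
(* With [k = -1] and the same prefix twice, linearity says that an edge of type 0 makes the rest of
   the expansion vanish. *)
rewrite (@telescope_lin_pre (-1) d _ [:: (0, T)] [:: (0, T)]) //.
  by rewrite scaleN1r addNr.
move=> r'; rewrite scaleN1r addNr -[0](subrr 0) -scaleN1r.
have := (graft_root_linl d [::] r' T (-1) 0 0).
by rewrite /= scaler0 addr0 scaleN1r addNr.
Qed.

Lemma graft_graft_root_mid d p c T r :
  graft c T (graft_root d (p ++ r)) = graft_root d (p ++ (c, T) :: r).
Proof.
rewrite graft_graft_root; apply: graft_root_perm.
by rewrite -cat1s perm_catCA.
Qed.

(** Replacing [kproj c] by [c - f c *: a], and likewise for [c'], the two orders differ by
    [f c * f c'] times the difference of the two sides of the hypothesis. The edges of [r1],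
    expanded earlier, appear in [x] already projected. *)
Lemma telescope_swap d pre r1 c T c' T' r2 :
  let x := graft_root d (pre ++ [seq (kproj e.1, e.2) | e <- r1] ++ r2) in
  B T (graft a T' x) = B T' (graft a T x) ->
  telescope d pre (r1 ++ (c, T) :: (c', T') :: r2) =
  telescope d pre (r1 ++ (c', T') :: (c, T) :: r2).
Proof.
elim: r1 pre => [|[c1 T1] r1 IH] pre /= E; last first.
  congr (_ *: B _ _ + _).
    apply: graft_root_perm; rewrite !perm_cat2l.
    exact: (permEl (perm_catCA [:: (c, T)] [:: (c', T')] r2)).
  by apply: IH; rewrite cat_rcons.
rewrite !cat_rcons -!graft_graft_root_mid !addrA.
rewrite (telescope_congr
  (pre' := rcons (rcons pre (kproj c', T')) (kproj c, T)));
  last first.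
  move=> r; rewrite !cat_rcons; apply: graft_root_perm; rewrite perm_cat2l.
  exact: (permEl (perm_catCA [:: (kproj c, T)] [:: (kproj c', T')] r)).
congr (_ + _); set x := graft_root _ _ in E *.
have kg c0 T0 : graft (kproj c0) T0 x = graft c0 T0 x - f c0 *: graft a T0 x.
  have gl := graft_linear_type T0 x.
  by rewrite /kproj (linB gl) (linZ gl).
rewrite !kg !(linB (Br _)) !(linZ (Br _)) E !scalerBr !scalerA (mulrC (f c')).
exact: addrCA.
Qed.

End Telescope.

(** * Construction of the morphism rank by rank *)

Section Freeness.
Variables (K : fieldType) (A : lmodType K) (D : Type).
Variable Phi : {linear tens A A -> tens A A}.
Hypothesis hPhi : is_lCEDS Phi.
Variables (a : A) (f : {scalar A}).
Hypotheses (aa : special1 Phi a) (fa : f a = 1).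
Local Notation tree := (ttree A D).
Local Notation g := (gtree A D).
Local Notation circ := (@Defs.circ K A D Phi a).
Local Notation delta := (@delta K A D Phi a).
Local Notation grafta := (@graft K A D a).
Implicit Types (T X : g) (t u : tree) (N : nat).

Lemma delta_graft_special X T x :
  delta X (grafta T x) = grafta T (delta X x) + grafta (circ X T) x.
Proof.
rewrite delta_graft aa tlift_tensor // => [q|p].
  exact: graft_linear_type.
exact: graft_circ_linear_type.
Qed.

Variables (M : lmodType K) (n : M -> M -> M) (phi : g -> M).
Hypothesis hn : is_prelie n.
Hypothesis phil : forall k,
  {in root_ker_space D f &, forall x y, phi (k *: x + y) = k *: phi x + phi y}.

Let nl y : linear (n^~ y). Proof. by case: hn. Qed.
Let nr x : linear (n x). Proof. by case: hn. Qed.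

(** The value that a morphism [F] must take on the grafting of [T] on the root of [x] by an edge of
    type [a]. *)
Definition graft_image (F : g -> M) T x : M := n (F T) (F x) - F (delta T x).

Lemma graft_image_linear_l F x : linear F -> linear (graft_image F^~ x).
Proof.
move=> Fl k T T'; rewrite /graft_image Fl nl delta_linear_l Fl.
by rewrite scalerBr opprD addrACA.
Qed.

Lemma graft_image_linear_r F T : linear F -> linear (graft_image F T).
Proof.
move=> Fl k x x'; rewrite /graft_image Fl nr delta_linear_r Fl.
by rewrite scalerBr opprD addrACA.
Qed.

(** The quantity bounded in the second clause is the rank of [u] with [t] grafted on its root, the
    largest rank occurring in the product. *)
Definition morph_below N (F : g -> M) : Prop :=
  [/\ linear F,
    forall t u,
      ((tree_size t + tree_size u) * (tree_size t + tree_size u) +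
        (arity u).+1 < N)%N ->
      F (circ (cls t) (cls u)) = n (F (cls t)) (F (cls u))
    & forall t, root_in_ker f t -> (rank t < N)%N -> F (cls t) = phi (cls t)].

Section Step.
Variables (N : nat) (F : g -> M).
Hypothesis FN : morph_below N F.

Let Fl : linear F. Proof. by case: FN. Qed.

Let F_circ m m' k X x :
  ((m + m') * (m + m') + k.+1 < N)%N ->
  X \in span (of_size m) -> x \in span (of_shape m' k) ->
  F (circ X x) = n (F X) (F x).
Proof.
move=> mN Xm; move: x; apply: span_linear_eq => [||_ [u [um uk ->]]].
- exact: (comp_linear Fl (circ_linear_r _ a X)).
- exact: (comp_linear (nr (F X)) Fl).
move: X Xm; apply: span_linear_eq => [||_ [t tm ->]].
- exact: (comp_linear Fl (circ_linear_l _ a (cls u))).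
- exact: (comp_linear (nl (F (cls u))) Fl).
by case: FN => _ Fc _; apply: Fc; rewrite tm um uk.
Qed.

Let F_graft m m' k X x :
  ((m + m') * (m + m') + k.+1 < N)%N ->
  X \in span (of_size m) -> x \in span (of_shape m' k) ->
  F (grafta X x) = graft_image F X x.
Proof.
move=> mN Xm xm; rewrite /graft_image -(F_circ mN Xm xm) circE (linD Fl).
by rewrite addrK.
Qed.

(** This is the exchange condition of [telescope_swap]. Everything inside has rank below [N], so [F]
    can be expanded; the difference of the two sides then vanishes by the pre-Lie identity of [n]
    and by [delta_assoc1_sym]. *)
Lemma graft_image_sym t1 t2 u :
  ((tree_size t1 + tree_size t2 + tree_size u) *
    (tree_size t1 + tree_size t2 + tree_size u) +
    (arity u).+2 <= N)%N ->
  graft_image F (cls t1) (grafta (cls t2) (cls u)) =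
  graft_image F (cls t2) (grafta (cls t1) (cls u)).
Proof.
move=> lt_N; set m1 := tree_size t1 in lt_N; set m2 := tree_size t2 in lt_N.
set m := tree_size u in lt_N; set k := arity u in lt_N.
have [m1_gt0 m2_gt0 m_gt0] : [/\ 0 < m1, 0 < m2 & 0 < m]%N.
  by split; apply: tree_size_gt0.
have S1 : cls t1 \in span (of_size m1) by apply: cls_size.
have S2 : cls t2 \in span (of_size m2) by apply: cls_size.
have Su : cls u \in span (of_shape m k) by apply: cls_shape.
have expand t t' : (tree_size t + tree_size t' = m1 + m2)%N ->
  graft_image F (cls t) (grafta (cls t') (cls u)) =
    n (F (cls t)) (n (F (cls t')) (F (cls u))) -
      n (n (F (cls t)) (F (cls t'))) (F (cls u)) -
    (n (F (cls t)) (F (delta (cls t') (cls u))) +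
      n (F (cls t')) (F (delta (cls t) (cls u)))) +
    F (delta (cls t') (delta (cls t) (cls u)) +
       delta (circ (cls t) (cls t')) (cls u)).
  move=> tt'; rewrite {1}/graft_image delta_graft_special (linD Fl).
  have [t_gt0 t'_gt0] := (tree_size_gt0 t, tree_size_gt0 t').
  have at' := arity_lt t'.
  have St := cls_size t; have St' := cls_size t'.
  rewrite (F_graft _ St' Su) -/m -/k; last by nia.
  rewrite (F_graft _ St' (delta_shape _ _ St Su)) -/m -/k; last by nia.
  rewrite (F_graft _ (circ_size _ a St St') Su) -/m -/k; last by nia.
  rewrite /graft_image (F_circ _ St (cls_shape t')); last by nia.
  rewrite (linB (nr _)) (linD Fl (delta _ (delta _ _))).
  rewrite [in LHS]opprD ![in LHS]opprB [in RHS]opprD.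
  by rewrite [LHS](AC (2*(2*2)) (((1*6)*(2*4))*(3*5))).
rewrite (expand t1 t2 erefl) (expand t2 t1 (addnC _ _)).
have -> : delta (cls t2) (delta (cls t1) (cls u)) +
       delta (circ (cls t1) (cls t2)) (cls u) =
    delta (cls t1) (delta (cls t2) (cls u)) +
       delta (circ (cls t2) (cls t1)) (cls u).
  have E := delta_assoc1_sym hPhi (cls t1) (cls t2) (cls u) aa.
  by rewrite (canRL (subrK _) E) [RHS]addrAC [X in _ = X + _]subrK.
congr (_ - _ + _); last exact: addrC.
by case: hn => _ _; apply.
Qed.

Definition step t : M :=
  if rank t == N then
    let: Node d s := t in telescope a f phi (graft_image F) d [::] (clss s)
  else F (cls t).

(** The relations preserve the rank, so only trees of rank [N] need an argument: there permutations
    are handled by [telescope_swap] and linearity by [telescope_linl] and [telescope_linr]. *)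
Lemma step_rel E : tree_rel E -> fglift step E = 0.
Proof.
have Bl := fun x => graft_image_linear_l x Fl.
have Br := fun T => graft_image_linear_r T Fl.
apply: fglift_tree_rel => [t t' tt'|k t t1 t2 tt].
  rewrite /step -(tree_perm_rank tt') -(cls_perm tt'); case: eqP => // tN.
  case: tt' tN => [d s s' ss' tN|d s1 s2 b u u' uu' _]; last first.
    by rewrite /clss !map_cat /= (cls_perm uu').
  (* The rank test is part of [G] because the expansion is known to be invariant under swaps only at
     rank [N], whereas [perm_eq_swap] asks for invariance on all lists. *)
  pose G s := if rank (Node d s) == N then
    telescope a f phi (graft_image F) d [::] (clss s) else 0.
  suff : G s = G s'.
    by rewrite /G -(tree_perm_rank (tree_perm_root d ss')) tN eqxx.
  apply: perm_eq_swap ss' => r1 [c u] [c' u'] r2; rewrite /G.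
  have sw : tree_perm (Node d (r1 ++ (c, u) :: (c', u') :: r2))
      (Node d (r1 ++ (c', u') :: (c, u) :: r2)).
    apply: tree_perm_root; rewrite perm_cat2l.
    exact: (permEl (perm_catCA [:: (c, u)] [:: (c', u')] r2)).
  rewrite -(tree_perm_rank sw); case: eqP => // rN.
  rewrite /clss !map_cat /=; apply: telescope_swap => //=.
  set r1' := [seq (kproj a f e.1, e.2) | e <- r1].
  have -> : [seq (kproj a f e.1, e.2) | e <- [seq (e.1, cls e.2) | e <- r1]] =
      clss r1' by rewrite /clss -!map_comp.
  rewrite -map_cat graft_root_cls; apply: graft_image_sym.
  move: rN; rewrite /rank !tree_size_node !big_cat !big_cons big_map /=.
  rewrite !size_cat /= size_map.
  move: (\sum_(e <- r1) _)%N (\sum_(e <- r2) _)%N => n1 n2.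
  have -> : (tree_size u + tree_size u' + (n1 + n2).+1)%N =
      (n1 + (tree_size u + (tree_size u' + n2))).+1 by lia.
  by move=> <-; rewrite leq_add2l !addnS.
rewrite /step; have [-> ->] := tree_lin_rank tt; rewrite (cls_lin tt).
case: eqP => [tN|_]; last exact: Fl.
case: tt tN => [d s1 s2 a1 a2 u _|d s1 s2 b u u1 u2 uu _].
  by rewrite /clss !map_cat /=; apply: telescope_linl.
by rewrite /clss !map_cat /= (cls_lin uu); apply: telescope_linr.
Qed.

Definition next : g -> M := lext step.

Lemma next_linear : linear next.
Proof. exact: lext_linear step_rel. Qed.

Lemma next_cls t : next (cls t) = step t.
Proof. exact: (lext_gen step_rel). Qed.

Lemma next_below x : x \in span (below N) -> next x = F x.
Proof.
apply: span_linear_eq => [||_ [t tN ->]] //; first exact: next_linear.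
by rewrite next_cls /step ltn_eqF.
Qed.

Lemma next_morph_below : morph_below N.+1 next.
Proof.
split=> [|t u tuN|t kt tN]; first exact: next_linear.
- have [t_gt0 au] := (tree_size_gt0 t, arity_lt u).
  have at_ := arity_lt t.
  have tb : cls t \in span (below N).
    by apply: shape_below (cls_shape t); nia.
  have ub : cls u \in span (below N).
    by apply: shape_below (cls_shape u); nia.
  have db : delta (cls t) (cls u) \in span (below N).
    by apply: shape_below (delta_shape _ _ (cls_size t) (cls_shape u)); lia.
  rewrite circE (linD next_linear) (next_below db) (next_below tb).
  rewrite (next_below ub).
  (* If the grafted tree has rank below [N], the property of [F] applies; otherwise its rank is
     exactly [N] and [telescope_a] computes its image. *)
  have [tu_lt|tu_ge] := ltnP
    ((tree_size t + tree_size u) * (tree_size t + tree_size u) +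
      (arity u).+1) N.
    rewrite next_below; last first.
      by apply: shape_below (graft_shape _ (cls_size t) (cls_shape u)).
    by rewrite (F_graft tu_lt) ?subrK // ?cls_size ?cls_shape.
  case: u au tb ub db tuN tu_ge => d s au tb ub db tuN tu_ge.
  rewrite graft_cls next_cls /step ifT; last first.
    by apply/eqP; rewrite /rank tree_size_cons /= in tuN tu_ge *; lia.
  have -> : clss ((a, t) :: s) = (a, cls t) :: clss s by [].
  rewrite telescope_a //; last first.
  + by move=> T; apply: graft_image_linear_r.
  by rewrite graft_root_cls subrK.
rewrite next_cls /step; case: eqP => [_|/eqP tN'].
  case: t kt {tN} => d s ks; rewrite telescope_ker ?graft_root_cls //.
  move=> _ /mapP[e es ->]; exact: ks.
by case: FN => _ _ Fp; apply: Fp => //; lia.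
Qed.

End Step.

(** * The limit of the partial morphisms *)

Fixpoint stage N : g -> M :=
  if N is N'.+1 then next N' (stage N') else fun=> 0.

Lemma stage_morph_below N : morph_below N (stage N).
Proof.
elim: N => [|N IH]; last exact: next_morph_below.
by split=> // k x y; rewrite scaler0 addr0.
Qed.

Let stage_linear N : linear (stage N).
Proof. by case: (stage_morph_below N). Qed.

Lemma stage_cls N t : (rank t < N)%N ->
  stage N (cls t) = stage (rank t).+1 (cls t).
Proof.
elim: N => // N IH; rewrite ltnS leq_eqVlt => /orP[/eqP <- //|tN].
rewrite -IH // [LHS](next_below (stage_morph_below N)) //.
by apply: mem_span; exists t.
Qed.

(** By [stage_cls], the stages are constant on [t] from this index on. *)
Definition limit (x : g) : M := lext (fun t => stage (rank t).+1 (cls t)) x.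

Lemma limit_rel E :
  tree_rel E -> fglift (fun t => stage (rank t).+1 (cls t)) E = 0.
Proof.
apply: fglift_tree_rel => [t t' tt'|k t t1 t2 tt].
  by rewrite (tree_perm_rank tt') (cls_perm tt').
by have [-> ->] := tree_lin_rank tt; rewrite (cls_lin tt); apply: stage_linear.
Qed.

Lemma limit_linear : linear limit.
Proof. exact: lext_linear limit_rel. Qed.

Lemma limit_below N x : x \in span (below N) -> limit x = stage N x.
Proof.
move: x; apply: span_linear_eq => [||_ [t tN ->]]; first exact: limit_linear.
  exact: stage_linear.
by rewrite stage_cls //; apply: (lext_gen limit_rel).
Qed.

Lemma limit_circ X x : limit (circ X x) = n (limit X) (limit x).
Proof.
move: x; apply: gtree_linear_eq => [||u].
- exact: (comp_linear limit_linear (circ_linear_r _ a X)).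
- exact: (comp_linear (nr (limit X)) limit_linear).
move: X; apply: gtree_linear_eq => [||t].
- exact: (comp_linear limit_linear (circ_linear_l _ a (cls u))).
- exact: (comp_linear (nl (limit (cls u))) limit_linear).
(* One more than the rank of the grafted tree, so that both factors and their product lie below
   [N]. *)
pose N := ((tree_size t + tree_size u) * (tree_size t + tree_size u) +
  (arity u).+2)%N.
have [t_gt0 u_gt0] := (tree_size_gt0 t, tree_size_gt0 u).
have [at_ au] := (arity_lt t, arity_lt u).
rewrite !(@limit_below N); first last.
- rewrite circE rpredD //.
    apply: shape_below (graft_shape _ (cls_size t) (cls_shape u)).
    by rewrite ltn_add2l.
  apply: shape_below (delta_shape _ _ (cls_size t) (cls_shape u)).
  by rewrite ltn_add2l.
- by apply: shape_below (cls_shape t); rewrite /N; nia.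
- by apply: shape_below (cls_shape u); rewrite /N; nia.
by case: (stage_morph_below N) => _ sc _; apply: sc; rewrite ltn_add2l.
Qed.

Lemma limit_phi : {in root_ker_space D f, limit =1 phi}.
Proof.
move=> x xV; have phi0 : phi 0 = 0.
  by have := phil (-1) (rpred0 _) (rpred0 _); rewrite !scaleN1r !addNr.
move/in_spanP: (xV); elim=> [|k _ v [t kt ->] /in_spanP vV IH].
  by rewrite phi0 (lin0 limit_linear).
rewrite limit_linear IH phil //; last by apply: mem_span; exists t.
congr (_ *: _ + _); rewrite (@limit_below (rank t).+1).
  by case: (stage_morph_below (rank t).+1) => _ _; apply.
by apply: mem_span; exists t.
Qed.

(** Strong induction on the rank; for a given tree, a second induction replaces the root edge types
    one by one by their projections to the kernel of [f], at constant rank. *)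
Lemma morph_unique (G1 G2 : g -> M) : linear G1 -> linear G2 ->
  {morph G1 : x y / circ x y >-> n x y} ->
  {morph G2 : x y / circ x y >-> n x y} ->
  {in root_ker_space D f, G1 =1 G2} -> G1 =1 G2.
Proof.
move=> l1 l2 m1 m2 eqV; apply: gtree_linear_eq => // t.
have [N] := ubnP (rank t); elim: N t => // N IHN [d s] sN.
have IH x : x \in span (below N) -> G1 x = G2 x.
  by move: x; apply: span_linear_eq => // _ [u uN ->]; apply: IHN.
(* The root edges become [pre ++ s], where [pre] collects those already projected. *)
rewrite -[s]cat0s in sN *.
have : root_in_ker f (Node d [::] : tree) by [].
elim: s [::] sN => [|[c u] s IHs] pre sN kpre.
  by rewrite cats0; apply/eqV/mem_span; exists (Node d pre).
have pp : perm_eq (pre ++ (c, u) :: s) ((c, u) :: pre ++ s).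
  exact: (permEl (perm_catCA pre [:: (c, u)] s)).
have gl := graft_linear_type (cls u) (cls (Node d (pre ++ s))).
have split_c : cls (Node d (pre ++ (c, u) :: s)) =
    f c *: grafta (cls u) (cls (Node d (pre ++ s))) +
    cls (Node d (rcons pre (kproj a f c, u) ++ s)).
  rewrite (cls_perm (tree_perm_root d pp)) -graft_cls.
  have -> : cls (Node d (rcons pre (kproj a f c, u) ++ s)) =
      graft (kproj a f c) (cls u) (cls (Node d (pre ++ s))).
    rewrite graft_cls; apply/cls_perm/tree_perm_root; rewrite cat_rcons.
    exact: (permEl (perm_catCA pre [:: (kproj a f c, u)] s)).
  by rewrite -gl /kproj addrC subrK.
have rk : rank (Node d (pre ++ (c, u) :: s)) =
    ((tree_size u + tree_size (Node d (pre ++ s))) *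
     (tree_size u + tree_size (Node d (pre ++ s))) +
     (arity (Node d (pre ++ s))).+1)%N.
  by rewrite (tree_perm_rank (tree_perm_root d pp)) /rank tree_size_cons.
rewrite split_c l1 l2 IHs; last 2 first.
- move: sN; rewrite cat_rcons /rank !tree_size_node !big_cat !big_cons /=.
  by rewrite !size_cat.
- move=> e; rewrite mem_rcons in_cons => /orP[/eqP->|]; last exact: kpre.
  exact: f_kproj.
congr (_ *: _ + _); rewrite rk ltnS in sN.
set x := Node d (pre ++ s) in sN *.
have [u_gt0 x_gt0] := (tree_size_gt0 u, tree_size_gt0 x).
have [au ax] := (arity_lt u, arity_lt x).
(* Both morphisms are determined on the product by their values on its factors; these factors and
   the [delta] term have smaller rank than the tree. *)
have -> : grafta (cls u) (cls x) = circ (cls u) (cls x) - delta (cls u) (cls x).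
  by rewrite circE addrK.
rewrite (linB l1) (linB l2) m1 m2 !IH //.
- by apply: shape_below (delta_shape _ _ (cls_size u) (cls_shape x)); lia.
- by apply: shape_below (cls_shape x); nia.
by apply: shape_below (cls_shape u); nia.
Qed.

End Freeness.

Theorem proposition2p10 (K : fieldType) (charK : [pchar K] =i pred0)
  (A : lmodType K) (Phi : {linear tens A A -> tens A A})
  (hPhi : is_lCEDS Phi) (D : Type) (a : A) (a_neq0 : a != 0)
  (a_special : special1 Phi a) (f : {scalar A}) (fa : f a = 1) :
  freely_generated (@circ K A D Phi a) (root_ker_space D f).
Proof.
split=> [|M n hn phi phil]; first exact: circ_prelie.
have limL := limit_linear hPhi a_special fa hn phil.
have limC := limit_circ hPhi a_special fa hn phil.
have limV := limit_phi hPhi a_special fa hn phil.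
pose F : {linear gtree A D -> M} := HB.pack (limit Phi a f n phi)
  (GRing.isLinear.Build K (gtree A D) M *:%R (limit Phi a f n phi) limL).
exists F; split=> // G Gm GV; apply: (morph_unique fa (linearP G) limL Gm limC).
by move=> x xV; rewrite GV // limV.
Qed.
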